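(* Let $\mathcal M=1$, $\mathcal N=2$ and $\hat K=\begin{pmatrix}0&0\\0&K_2\end{pmatrix}$ with $K_2$ an invertible diagonalizable $2\times2$ matrix with eigenvalues $\mathsf k_2\ne\mathsf k_3$, $\mathsf k_2\mathsf k_3\ne0$. For almost every choice of inhomogeneities with $\xi_a-\xi_b\notin\eta\mathbb Z$ ($a\ne b$), the set of eigenvalues of $T^{(\hat K)}_1(\lambda)$ equals $$\Sigma=\Big\{t_1(\lambda)=-(\mathsf k_2+\mathsf k_3)d(\lambda)+\sum_{a=1}^{\mathsf N}f^{(1)}_a(\lambda)x_a\ :\ (x_1,\dots,x_{\mathsf N})\in S\Big\},$$ where $S$ is the set of solutions $(x_1,\dots,x_{\mathsf N})\in\mathbb C^{\mathsf N}$ of the system of $\mathsf N$ cubic equations $$x_a\Big[\mathsf k_2\mathsf k_3\,d(\xi_a+\eta)+\sum_{r=1}^{\mathsf N}f^{(2)}_r(\xi_a+\eta)\,t_1(\xi_r+\eta)\,x_r\Big]=0,\qquad a=1,\dots,\mathsf N,$$ with $t_1(\lambda)=-(\mathsf k_2+\mathsf k_3)d(\lambda)+\sum_{a}f^{(1)}_a(\lambda)x_a$. Moreover $T^{(\hat K)}_1(\lambda)$ is diagonalizable with simple spectrum, and for each $t_1\in\Sigma$ the unique (up to normalization) eigenvector $|t\rangle$ satisfies $\langle h_1,\dots,h_{\mathsf N}|t\rangle=\prod_{n=1}^{\mathsf N}t_1(\xi_n)^{h_n}$ for all $(h_1,\dots,h_{\mathsf N})\in\{0,1,2\}^{\mathsf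 N}$, where $\langle h_1,\dots,h_{\mathsf N}|=\langle S|\prod_{n}(T^{(\hat K)}_1(\xi_n))^{h_n}$ is the SoV covector basis (for a generic covector $\langle S|$).
   Context: Fix a nonzero complex number $\eta$, an integer $\mathsf N\ge1$ and complex inhomogeneities $\xi_1,\dots,\xi_{\mathsf N}$. Let $V=\mathbb C^{1|2}$ be the super vector space with homogeneous basis $v_1,v_2,v_3$, $v_1$ even and $v_2,v_3$ odd ($\bar1=0$, $\bar2=\bar3=1$); let $e^j_i\in\operatorname{End}V$ be defined by $e^j_iv_k=\delta_{jk}v_i$. Tensor products are graded: $(a_1\otimes b_1)(a_2\otimes b_2)=(-1)^{\bar b_1\bar a_2}a_1a_2\otimes b_1b_2$ and $(a\otimes b)(v\otimes w)=(-1)^{\bar b\bar v}av\otimes bw$. The graded permutation is $\mathbb P=\sum_{\alpha,\beta}(-1)^{\bar\beta}e^\beta_\alpha\otimes e^\alpha_\beta$; the supertrace is $\operatorname{str}(e^j_i)=(-1)^{\bar j}\delta_{ij}$; $R(\lambda)=\lambda\,\mathbb I\otimes\mathbb I+\eta\mathbb P$. For a twist $K=\operatorname{diag}(\mathsf k_1,K_2)$ (with $K_2$ a $2\times2$ block), $\mathcal H=V_1\otimes\cdots\otimes V_{\mathsf N}$, the monodromy is $M^{(K)}_0(\lambda)=K_0R_{0\mathsf N}(\lambda-\xi_{\mathsf N})\cdots R_{01}(\lambda-\xi_1)$ and $T^{(K)}_1(\lambda)=\operatorname{str}_0M^{(K)}_0(\lambda)$. Write $d(\lambda)=\prod_{n=1}^{\mathsf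 N}(\lambda-\xi_n)$. Let $f^{(m)}_a(\lambda)=\prod_{b\ne a}\frac{\lambda-\xi_b}{\xi_a-\xi_b}\prod_{b=1}^{\mathsf N}\prod_{r=1}^{m-1}\frac{1}{\xi_a-\xi_b+r\eta}$. ''Almost every'' means outside a proper algebraic subset of parameter space. *)

(* Defs.v *)
From HB Require Import structures.
From mathcomp Require Import all_boot all_order all_algebra.
Set Implicit Arguments. Unset Strict Implicit. Unset Printing Implicit Defensive.
Import Order.TTheory GRing.Theory Num.Theory.
Local Open Scope ring_scope.

Section Defs.
Variable C : numClosedFieldType.

(* Basis v_1, v_2, v_3 of C^{1|2} is indexed by 'I_3 = {0,1,2};
   index 0 (= v_1) is even, indices 1,2 (= v_2, v_3) are odd. *)
Definition deg (i : 'I_3) : nat := (i != ord0).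

(* Operators on the span of a finite basis I: matrix entries A c d =
   coefficient of basis vector c in A (basis vector d). *)
Definition op (I : finType) := I -> I -> C.
Definition vec (I : finType) := I -> C.
Definition opmul (I : finType) (A B : op I) : op I :=
  fun c d => \sum_(e : I) A c e * B e d.
Definition opid (I : finType) : op I := fun c d => (c == d)%:R.
Definition opapp (I : finType) (A : op I) (v : vec I) : vec I :=
  fun c => \sum_(d : I) A c d * v d.
Definition unitvec (I : finType) (d : I) : vec I := fun c => (c == d)%:R.
Definition nonzero_vec (I : finType) (v : vec I) : Prop := exists c, v c != 0.

Definition mpeval (I : finType) (p : seq (C * (I -> nat))) (x : I -> C) : C :=
  \sum_(m <- p) m.1 * \prod_(i : I) x i ^+ m.2 i.

Definition linindep (I J : finType) (vs : I -> vec J) : Prop :=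
  forall a : I -> C, (forall c, \sum_(h : I) a h * vs h c = 0) -> forall h, a h = 0.

Variable N : nat.

(* Basis of V_0 (x) V_1 (x) ... (x) V_N : site 0 is the auxiliary space,
   site n.+1 is the quantum site n+1. Basis of H = V_1 (x) ... (x) V_N. *)
Definition sconf := {ffun 'I_N.+1 -> 'I_3}.
Definition hconf := {ffun 'I_N -> 'I_3}.

(* e^j_i (maps v_j to v_i) acting on site k, with the graded (Koszul) sign
   arising from the graded tensor product. *)
Definition emb (k : 'I_N.+1) (i j : 'I_3) : op sconf :=
  fun c d =>
    if (d k == j) && (c == [ffun m => if m == k then i else d m])
    then (-1) ^+ ((deg i + deg j) * (\sum_(m < N.+1 | (m < k)%N) deg (d m)))%N
    else 0.

Definition Pperm (k : 'I_N.+1) : op sconf :=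
  fun c d => \sum_(a < 3) \sum_(b < 3)
     (-1) ^+ deg b * opmul (emb ord0 a b) (emb k b a) c d.

Definition Rop (eta mu : C) (k : 'I_N.+1) : op sconf :=
  fun c d => mu * (c == d)%:R + eta * Pperm k c d.

Definition Kop (K : 'I_3 -> 'I_3 -> C) : op sconf :=
  fun c d => \sum_(i < 3) \sum_(j < 3) K i j * emb ord0 i j c d.

Definition monodromy (K : 'I_3 -> 'I_3 -> C) (eta : C) (xi : 'I_N -> C)
  (lam : C) : op sconf :=
  opmul (Kop K)
    (foldr (fun m acc => opmul (Rop eta (lam - xi m) (lift ord0 m)) acc)
       (@opid sconf) (rev (enum 'I_N))).

Definition ext (i : 'I_3) (c : hconf) : sconf :=
  [ffun k => if unlift ord0 k is Some m then c m else i].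

Definition parity (c : hconf) : nat := (\sum_(m < N) deg (c m))%N.

Definition str0 (A : op sconf) : op hconf :=
  fun c d => \sum_(i < 3)
    (-1) ^+ (deg i + deg i * (parity c + parity d))%N * A (ext i c) (ext i d).

Definition T1 (K : 'I_3 -> 'I_3 -> C) (eta : C) (xi : 'I_N -> C) (lam : C)
  : op hconf := str0 (monodromy K eta xi lam).

Definition Khat (K2 : 'M[C]_2) : 'I_3 -> 'I_3 -> C :=
  fun i j => match unlift ord0 i, unlift ord0 j with
             | Some a, Some b => K2 a b
             | _, _ => 0 end.

Definition dfun (xi : 'I_N -> C) (lam : C) : C := \prod_(n < N) (lam - xi n).

Definition fm (m : nat) (eta : C) (xi : 'I_N -> C) (a : 'I_N) (lam : C) : C :=
  (\prod_(b < N | b != a) ((lam - xi b) / (xi a - xi b))) *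
  \prod_(b < N) \prod_(1 <= r < m) (xi a - xi b + r%:R * eta)^-1.

Definition t1x (k2 k3 eta : C) (xi : 'I_N -> C) (x : 'I_N -> C) (lam : C) : C :=
  - (k2 + k3) * dfun xi lam + \sum_(a < N) fm 1 eta xi a lam * x a.

Definition inS (k2 k3 eta : C) (xi : 'I_N -> C) (x : 'I_N -> C) : Prop :=
  forall a : 'I_N,
    x a * (k2 * k3 * dfun xi (xi a + eta)
           + \sum_(r < N) fm 2 eta xi r (xi a + eta)
                          * t1x k2 k3 eta xi x (xi r + eta) * x r) = 0.

Definition is_eigenvalue (T : C -> op hconf) (t : C -> C) : Prop :=
  exists v : vec hconf, nonzero_vec v /\
    forall lam c, opapp (T lam) v c = t lam * v c.

Definition covh (T : C -> op hconf) (xi : 'I_N -> C) (S : vec hconf)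
  (h : hconf) (v : vec hconf) : C :=
  \sum_(c : hconf) S c *
    (foldr (fun n w => iter (h n) (opapp (T (xi n))) w) v (enum 'I_N)) c.

End Defs.

(* Main.v *)
(** With the first twist eigenvalue equal to 0, the auxiliary space starts and
    ends in an odd state, so the transfer matrix can only carry the even vectors
    v_1 towards higher sites: it is block triangular with respect to the set A of
    sites occupied by v_1. The diagonal block attached to A is d_A times a gl(2)
    transfer matrix on the complement of A, whose quantum determinant gives
      t(xi_b) t(xi_b + eta) = k2 k3 d(xi_b + eta) prod_n (xi_b - zeta_n)
    with zeta_n = xi_n for n in A and xi_n + eta otherwise. Together with
    t(xi_a) = 0 on A, this is equivalent to the cubic system, by uniqueness of a
    polynomial of degree N with given leading coefficient and N given values.

    Conversely, interpolating t at the nodes zeta shows that the functions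
    1_{A(x) = A} prod_{a in B} x_a (A and B disjoint sets of sites) separate the
    solutions linearly, so there are at most 3^N of them, and any 3^N distinct
    joint eigenvalues exhaust S. Simplicity of the spectrum and independence of
    the covectors are polynomial conditions on xi; they hold along xi_b = b / u
    for small u because T(xi_a), suitably normalised, tends to eta K_a, and these
    operators have a simple joint spectrum. *)

(* Completeness of the cubic system rests on a count of solutions without multiplicities or points
   at infinity. On solutions with a fixed zero set, the span of squarefree monomials is stable under
   multiplication by every [x_a]: where [x_b] is present, the interpolation node [xi_b + eta] is
   used, because [x_b t(xi_b + eta)] is a constant there; where it is absent, the node [xi_b] is
   used, because [t(xi_b) = x_b]. A linear relation among evaluations therefore survives
   multiplication by any polynomial, and a Lagrange product isolates each solution.

   The conditions on the twist enter at the base point: the eigenvalues [0, k2, k3] of the full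
   twist must be distinct for the operators [eta K_a] to separate product eigenvectors and for a
   Vandermonde matrix to give independent covectors. The base point lies at infinity in [xi];
   rescaling makes it the value at [u = 0] of a polynomial in [u], which then stays nonzero at some
   [u != 0]. That point only has to make the certificate nonzero; non-resonance of [xi] is a
   separate hypothesis. *)
Require Import Defs.
From Stdlib Require Import FunctionalExtensionality.
From HB Require Import structures.
From mathcomp Require Import all_boot all_order all_algebra.
From mathcomp Require Import ring.
Set Implicit Arguments. Unset Strict Implicit. Unset Printing Implicit Defensive.
Import Order.TTheory GRing.Theory Num.Theory.
Local Open Scope ring_scope.

(** * The vertex model *)

Section Vertex.
Variables (C : numClosedFieldType) (N : nat).
Local Notation H := (hconf N).

Definition upd (c : H) (n : 'I_N) (i : 'I_3) : H :=
  [ffun m => if m == n then i else c m].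

Lemma upd_same c n i : upd c n i n = i.
Proof. by rewrite ffunE eqxx. Qed.

Lemma upd_other c n i m : m != n -> upd c n i m = c m.
Proof. by rewrite ffunE => /negPf->. Qed.

Lemma upd_upd c n i j : upd (upd c n i) n j = upd c n j.
Proof. by apply/ffunP => m; rewrite !ffunE; case: eqP. Qed.

Lemma upd_id c n : upd c n (c n) = c.
Proof. by apply/ffunP => m; rewrite !ffunE; case: eqP => [->|]. Qed.

Lemma updC c n m i j : m != n -> upd (upd c n i) m j = upd (upd c m j) n i.
Proof.
move=> mn; apply/ffunP => k; rewrite !ffunE.
by case: (eqVneq k m) => [->|] //; rewrite (negPf mn).
Qed.

Variables (sp se : 'I_3 -> 'I_3 -> C).

(* Operators are applied to functions of the auxiliary index i and of the
   configuration c: al is the weight of passing, be that of exchanging the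
   auxiliary state with the state of site n; sp and se are signs. *)
Definition lop (al be : 'I_N -> C) (n : 'I_N) (u : 'I_3 -> H -> C)
  : 'I_3 -> H -> C :=
  fun i c => al n * sp i (c n) * u i c
             + be n * se i (c n) * u (c n) (upd c n i).

Definition mon al be s u := foldr (lop al be) u s.

Definition aux1 (i0 : 'I_3) (v : H -> C) : 'I_3 -> H -> C :=
  fun i c => (i == i0)%:R * v c.

Definition sites := rev (enum 'I_N).

Lemma sites_uniq : uniq sites.
Proof. by rewrite rev_uniq enum_uniq. Qed.

(** The leading minus is the supertrace sign of the odd auxiliary states, the only ones that a twist
    with zero first row and column lets through. The auxiliary line starts in [p.1], leaves the
    sites in [p.2], and the twist closes it. *)
Definition transfer (K : 'I_3 -> 'I_3 -> C) al be (v : H -> C) : H -> C :=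
  fun c => - \sum_(p : 'I_3 * 'I_3)
               K p.1 p.2 * mon al be sites (aux1 p.1 v) p.2 c.

Lemma mon_sum al be s (J : finType) (a : J -> C) (u : J -> 'I_3 -> H -> C) i c :
  mon al be s (fun i' c' => \sum_k a k * u k i' c') i c
  = \sum_k a k * mon al be s (u k) i c.
Proof.
elim: s i c => [|n s IH] i c //=.
rewrite /lop !IH !mulr_sumr -big_split /=.
by apply: eq_bigr => k _; ring.
Qed.

Lemma monZ al be s (a : C) u i c :
  mon al be s (fun i' c' => a * u i' c') i c = a * mon al be s u i c.
Proof.
by elim: s i c => [|n s IH] i c //=; rewrite /lop !IH; ring.
Qed.

Lemma mon_local al be (f : 'I_3 -> C) n s u i c : n \notin s ->
  mon al be s (fun i' c' => f (c' n) * u i' c') i c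
  = f (c n) * mon al be s u i c.
Proof.
elim: s i c => [|m s IH] //= i c; rewrite inE negb_or => /andP[nm ns].
by rewrite /lop !IH // upd_other //; ring.
Qed.

Lemma transferZ K al be (a : C) v c :
  transfer K al be (fun d => a * v d) c = a * transfer K al be v c.
Proof.
rewrite /transfer mulrN mulr_sumr; congr (- _); apply: eq_bigr => p _.
rewrite mulrCA -[X in _ = _ * X]monZ; congr (_ * mon _ _ _ _ _ _).
by do 2!apply: functional_extensionality => ?; rewrite /aux1 mulrCA.
Qed.

Lemma mon_scale al be (k : 'I_N -> C) s u i c :
  mon (fun n => k n * al n) (fun n => k n * be n) s u i c
  = (\prod_(n <- s) k n) * mon al be s u i c.
Proof.
elim: s i c => [|n s IH] i c; first by rewrite big_nil mul1r.
by rewrite big_cons /= {1}/lop !IH /lop; ring.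
Qed.

Lemma transfer_scale K al be (k : 'I_N -> C) v c :
  transfer K (fun n => k n * al n) (fun n => k n * be n) v c
  = (\prod_n k n) * transfer K al be v c.
Proof.
rewrite /transfer mulrN mulr_sumr; congr (- _); apply: eq_bigr => p _.
rewrite mon_scale mulrCA; congr (_ * _).
by rewrite [RHS]big_enum_val /= /sites (perm_big _ (permEl (perm_rev _)))
   -big_enum_val big_enum.
Qed.

Definition aux2 (i1 i2 : 'I_3) (v : H -> C) : 'I_3 -> 'I_3 -> H -> C :=
  fun i j c => (i == i1)%:R * (j == i2)%:R * v c.

Definition lop1 al be n (u : 'I_3 -> 'I_3 -> H -> C) : 'I_3 -> 'I_3 -> H -> C :=
  fun i j => lop al be n (fun i' => u i' j) i.
Definition lop2 al be n (u : 'I_3 -> 'I_3 -> H -> C) : 'I_3 -> 'I_3 -> H -> C :=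
  fun i => lop al be n (u i).

Lemma foldr_lop1 al be s u :
  foldr (lop1 al be) u s = fun i j => mon al be s (fun i' => u i' j) i.
Proof. by elim: s => //= n s ->. Qed.

Lemma foldr_lop2 al be s u :
  foldr (lop2 al be) u s = fun i => mon al be s (u i).
Proof. by elim: s => //= n s ->. Qed.

(** The two vertices share neither an auxiliary line nor a site, and no Koszul string connects them,
    so they act on disjoint data. *)
Lemma lop12C al be al' be' m n u : m != n ->
  lop1 al be m (lop2 al' be' n u) = lop2 al' be' n (lop1 al be m u).
Proof.
move=> mn; do 3!apply: functional_extensionality => ?.
rewrite /lop1 /lop2 /lop (upd_other _ _ mn) upd_other 1?eq_sym //.
rewrite ?(updC _ _ _ mn); ring.
Qed.

Variables (al be al' be' : 'I_N -> C).

Definition mon12 s (u : 'I_3 -> 'I_3 -> H -> C) :=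
  foldr (fun n w => lop1 al be n (lop2 al' be' n w)) u s.
Definition mon21 s (u : 'I_3 -> 'I_3 -> H -> C) :=
  foldr (fun n w => lop2 al' be' n (lop1 al be n w)) u s.

Lemma foldr_lop1_lop2 s n u : n \notin s ->
  foldr (lop1 al be) (lop2 al' be' n u) s
  = lop2 al' be' n (foldr (lop1 al be) u s).
Proof.
elim: s => //= m s IH; rewrite inE negb_or eq_sym => /andP[mn ns].
by rewrite IH // lop12C.
Qed.

Lemma foldr_lop2_lop1 s n u : n \notin s ->
  foldr (lop2 al' be') (lop1 al be n u) s
  = lop1 al be n (foldr (lop2 al' be') u s).
Proof.
elim: s => //= m s IH; rewrite inE negb_or => /andP[mn ns].
by rewrite IH // lop12C.
Qed.

(** Regroups two stacked rows of vertices column by column, so that an identity at one site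
    propagates along the chain. *)
Lemma mon12E s u : uniq s ->
  foldr (lop1 al be) (foldr (lop2 al' be') u s) s = mon12 s u.
Proof.
elim: s u => //= n s IH u /andP[ns us].
by rewrite foldr_lop1_lop2 // IH.
Qed.

Lemma mon21E s u : uniq s ->
  foldr (lop2 al' be') (foldr (lop1 al be) u s) s = mon21 s u.
Proof.
elim: s u => //= n s IH u /andP[ns us].
by rewrite foldr_lop2_lop1 // IH.
Qed.

Lemma mon12_sum s (J : finType) (a : J -> C) u i j c :
  mon12 s (fun i' j' c' => \sum_(k : J) a k * u k i' j' c') i j c
  = \sum_k a k * mon12 s (u k) i j c.
Proof.
elim: s i j c => [|n s IH] i j c //=.
rewrite /lop1 /lop2 /lop !IH !mulr_sumr -!big_split /= !mulr_sumr -big_split /=.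
by apply: eq_bigr => k _; ring.
Qed.

Lemma mon21_sum s (J : finType) (a : J -> C) u i j c :
  mon21 s (fun i' j' c' => \sum_(k : J) a k * u k i' j' c') i j c
  = \sum_k a k * mon21 s (u k) i j c.
Proof.
elim: s i j c => [|n s IH] i j c //=.
rewrite /lop1 /lop2 /lop !IH !mulr_sumr -!big_split /= !mulr_sumr -big_split /=.
by apply: eq_bigr => k _; ring.
Qed.

Lemma transfer_comp12 K v c :
  transfer K al be (transfer K al' be' v) c
  = \sum_(p : 'I_3 * 'I_3) \sum_(q : 'I_3 * 'I_3)
      K p.1 p.2 * K q.1 q.2 * mon12 sites (aux2 p.1 q.1 v) p.2 q.2 c.
Proof.
rewrite /transfer -sumrN; apply: eq_bigr => p _.
transitivity (- (K p.1 p.2 * \sum_(q : 'I_3 * 'I_3) - K q.1 q.2 *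
   mon al be sites (aux1 p.1 (mon al' be' sites (aux1 q.1 v) q.2)) p.2 c)).
  congr (- (_ * _)); rewrite -mon_sum; congr (mon _ _ _ _ _ _).
  do 2!apply: functional_extensionality => ?.
  by rewrite /aux1 mulrN mulr_sumr -sumrN; apply: eq_bigr => q _; ring.
rewrite mulr_sumr -sumrN; apply: eq_bigr => q _.
rewrite -mon12E ?sites_uniq // foldr_lop1 foldr_lop2 /=.
rewrite mulrA mulrN mulNr opprK; congr (_ * mon _ _ _ _ _ _).
apply: functional_extensionality => i; apply: functional_extensionality => d.
rewrite /aux1 -monZ; congr (mon _ _ _ _ _ _).
by do 2!apply: functional_extensionality => ?; rewrite /aux2 mulrA.
Qed.

Lemma transfer_comp21 K v c :
  transfer K al' be' (transfer K al be v) c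
  = \sum_(p : 'I_3 * 'I_3) \sum_(q : 'I_3 * 'I_3)
      K p.1 p.2 * K q.1 q.2 * mon21 sites (aux2 p.1 q.1 v) p.2 q.2 c.
Proof.
rewrite exchange_big /= /transfer -sumrN; apply: eq_bigr => p _.
transitivity (- (K p.1 p.2 * \sum_(q : 'I_3 * 'I_3) - K q.1 q.2 *
   mon al' be' sites (aux1 p.1 (mon al be sites (aux1 q.1 v) q.2)) p.2 c)).
  congr (- (_ * _)); rewrite -mon_sum; congr (mon _ _ _ _ _ _).
  do 2!apply: functional_extensionality => ?.
  by rewrite /aux1 mulrN mulr_sumr -sumrN; apply: eq_bigr => q _; ring.
rewrite mulr_sumr -sumrN; apply: eq_bigr => q _.
rewrite -mon21E ?sites_uniq // foldr_lop1 foldr_lop2 /=.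
rewrite mulrA mulrN mulNr opprK [K q.1 _ * _]mulrC; congr (_ * mon _ _ _ _ _ _).
apply: functional_extensionality => i; apply: functional_extensionality => d.
rewrite /aux1 -monZ; congr (mon _ _ _ _ _ _).
by do 2!apply: functional_extensionality => ?; rewrite /aux2 mulrCA mulrA.
Qed.

End Vertex.

(** * Yang-Baxter relation and commutation *)

Section Graded.
Variables (C : numClosedFieldType) (N : nat).
Local Notation H := (hconf N).

(* Signs left once the auxiliary space is moved along the chain instead of being
   connected to each site by a string of Koszul signs, and once the parity sign
   of the supertrace is distributed over the sites. *)
Definition gsp (i s : 'I_3) : C := (-1) ^+ (deg s * (deg i).+1).
Definition gse (i s : 'I_3) : C := (-1) ^+ deg i.

(** The R-matrix intertwining two auxiliary lines, in the sign convention of [gsp] and [gse]: the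
    grading survives only as a sign on two even states. *)
Definition rop (d eta : C) (u : 'I_3 -> 'I_3 -> H -> C) : 'I_3 -> 'I_3 -> H -> C :=
  fun i j c => d * (-1) ^+ ((i == ord0) && (j == ord0)) * u i j c - eta * u j i c.

Lemma yang_baxter (eta d : C) (al al' : 'I_N -> C) n u : al n - al' n = d ->
  rop d eta (lop1 gsp gse al (fun=> eta) n (lop2 gsp gse al' (fun=> eta) n u))
  = lop2 gsp gse al' (fun=> eta) n (lop1 gsp gse al (fun=> eta) n (rop d eta u)).
Proof.
move=> <-; apply: functional_extensionality => i.
apply: functional_extensionality => j; apply: functional_extensionality => c.
(* Writing the configuration as [upd c n s] makes all nested updates collapse; eight parity cases
   remain. *)
suff: forall s, rop (al n - al' n) eta (lop1 gsp gse al (fun=> eta) n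
     (lop2 gsp gse al' (fun=> eta) n u)) i j (upd c n s)
  = lop2 gsp gse al' (fun=> eta) n
     (lop1 gsp gse al (fun=> eta) n (rop (al n - al' n) eta u)) i j (upd c n s).
  by move/(_ (c n)); rewrite upd_id.
move=> s; rewrite /rop /lop1 /lop2 /lop /gsp /gse !upd_same !upd_upd.
rewrite /deg; case: (eqVneq i ord0) => [->|/negPf ni];
case: (eqVneq j ord0) => [->|/negPf nj];
case: (eqVneq s ord0) => [->|/negPf ns]; rewrite ?eqxx ?ni ?nj ?ns /=; ring.
Qed.

Lemma rop_mon12 (eta d : C) (al al' : 'I_N -> C) s u :
  (forall n, al n - al' n = d) ->
  rop d eta (mon12 gsp gse al (fun=> eta) al' (fun=> eta) s u)
  = mon21 gsp gse al (fun=> eta) al' (fun=> eta) s (rop d eta u).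
Proof.
by move=> ald; elim: s => //= n s IH; rewrite yang_baxter // IH.
Qed.

End Graded.

Section Commute.
Variables (C : numClosedFieldType) (N : nat).
Local Notation H := (hconf N).
Variable (K : 'I_3 -> 'I_3 -> C).
Hypothesis K0l : forall j, K ord0 j = 0.
Hypothesis K0r : forall i, K i ord0 = 0.

(** The intertwiner is not inverted. Contracting its relation with two copies of [K] gives two
    linear equations linking [S x] and its output-swapped version to those of [y]; their determinant
    is [d ^+ 2 - eta ^+ 2]. *)
Lemma transfer_comm (eta : C) (al al' : 'I_N -> C) d v c :
  (forall n, al n - al' n = d) -> d ^+ 2 != eta ^+ 2 ->
  transfer (@gsp C) (@gse C) K al (fun=> eta)
    (transfer (@gsp C) (@gse C) K al' (fun=> eta) v) c
  = transfer (@gsp C) (@gse C) K al' (fun=> eta)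
      (transfer (@gsp C) (@gse C) K al (fun=> eta) v) c.
Proof.
move=> ald dN; rewrite transfer_comp12 transfer_comp21.
set X := mon12 _ _ _ _ _ _ _; set Y := mon21 _ _ _ _ _ _ _.
pose x i1 i2 j1 j2 := X (aux2 i1 i2 v) j1 j2 c.
pose y i1 i2 j1 j2 := Y (aux2 i1 i2 v) j1 j2 c.
have XY i1 i2 j1 j2 : i1 != ord0 -> j1 != ord0 ->
  d * x i1 i2 j1 j2 - eta * x i1 i2 j2 j1
  = d * y i1 i2 j1 j2 - eta * y i2 i1 j1 j2.
  move=> i10 j10.
  have := congr1 (fun f => f j1 j2 c) (@rop_mon12 C N eta d al al' (sites N) (aux2 i1 i2 v) ald).
  rewrite -/X -/Y {1}/rop (negPf j10) /= mulr1 -/(x i1 i2 j1 j2) -/(x i1 i2 j2 j1) => ->.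
  have -> : rop d eta (aux2 i1 i2 v) = fun i j c =>
     \sum_(b : bool) (if b then d else - eta) *
        (if b then aux2 i1 i2 v else aux2 i2 i1 v) i j c.
    apply: functional_extensionality => i; apply: functional_extensionality => j.
    apply: functional_extensionality => e.
    rewrite big_bool /= /rop /aux2.
    case: (eqVneq i ord0) => [->|ni] /=; last by ring.
    by rewrite [ord0 == i1]eq_sym (negPf i10) /=; ring.
  by rewrite /Y mon21_sum big_bool /= mulNr.
pose S (z : 'I_3 -> 'I_3 -> 'I_3 -> 'I_3 -> C) : C :=
  \sum_(p : 'I_3 * 'I_3) \sum_(q : 'I_3 * 'I_3)
     K p.1 p.2 * K q.1 q.2 * z p.1 q.1 p.2 q.2.
pose fl (z : 'I_3 -> 'I_3 -> 'I_3 -> 'I_3 -> C) i1 i2 j1 j2 := z i1 i2 j2 j1.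
(* Renaming both lines at once changes nothing, so swapping the inputs amounts to swapping the
   outputs. *)
have Sswap z : S (fun i1 i2 j1 j2 => z i2 i1 j2 j1) = S z.
  rewrite /S exchange_big; apply: eq_bigr => q _; apply: eq_bigr => p _ /=.
  by rewrite [K p.1 _ * _]mulrC.
have SE z z' : (forall i1 i2 j1 j2, i1 != ord0 -> j1 != ord0 -> j2 != ord0 ->
    z i1 i2 j1 j2 = z' i1 i2 j1 j2) -> S z = S z'.
  move=> zz'; apply: eq_bigr => -[i1 j1] _; apply: eq_bigr => -[i2 j2] _ /=.
  have [->|i10] := eqVneq i1 ord0; first by rewrite K0l !mul0r.
  have [->|j10] := eqVneq j1 ord0; first by rewrite K0r !mul0r.
  have [->|j20] := eqVneq j2 ord0; first by rewrite K0r !(mulr0, mul0r).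
  by rewrite zz'.
have SD z z' : S (fun i1 i2 j1 j2 => d * z i1 i2 j1 j2 - eta * z' i1 i2 j1 j2)
             = d * S z - eta * S z'.
  rewrite /S !mulr_sumr -sumrN -big_split; apply: eq_bigr => p _ /=.
  rewrite !mulr_sumr -sumrN -big_split; apply: eq_bigr => q _ /=; ring.
have E1 : d * S x - eta * S (fl x) = d * S y - eta * S (fl y).
  rewrite -(Sswap (fl y)) -!SD; apply: SE => i1 i2 j1 j2 *; exact: XY.
have E2 : d * S (fl x) - eta * S x = d * S (fl y) - eta * S y.
  rewrite -(Sswap y) -!SD; apply: SE => i1 i2 j1 j2 *; exact: XY.
change (S x = S y); apply/eqP; rewrite -subr_eq0.
have : (d ^+ 2 - eta ^+ 2) * (S x - S y) = 0.
  transitivity (d * (d * S x - eta * S (fl x) - (d * S y - eta * S (fl y)))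
     + eta * (d * S (fl x) - eta * S x - (d * S (fl y) - eta * S y))); first by ring.
  by rewrite E1 E2 !subrr !mulr0 addr0.
by move/eqP; rewrite mulf_eq0 (subr_eq0 (d ^+ 2)) (negPf dN).
Qed.
End Commute.

(** * The diagonal blocks *)

Section Flat.
Variables (C : numClosedFieldType) (N : nat).
Local Notation H := (hconf N).

(* The part of [lop] that leaves the positions of v_1 unchanged. *)
Definition fsp (i s : 'I_3) : C := 1.
Definition fse (i s : 'I_3) : C := - ((i != ord0) && (s != ord0))%:R.

(** Serves to cut an eigenvector down to one diagonal block, with [chi] the indicator of a set of
    positions of [v_1]. *)
Lemma flat_mon_shape (chi : H -> C) al be s u i c :
  (forall n j (d : H), j != ord0 -> d n != ord0 -> chi (upd d n j) = chi d) ->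
  mon fsp fse al be s (fun i' c' => chi c' * u i' c') i c
  = chi c * mon fsp fse al be s u i c.
Proof.
move=> chiP; elim: s i c => [|n s IH] i c //=.
rewrite /lop !IH /fse; case: (boolP (_ && _)) => [/andP[i0 c0]|_].
  rewrite chiP //; ring.
by rewrite oppr0 mulr0 !mul0r !addr0; ring.
Qed.

(** Source of [t(xi_a) = 0] on A: at a site holding [v_1] passing is the only move left, and its
    weight is zero. *)
Lemma flat_mon_eq0 al be s u i (c : H) n :
  n \in s -> c n = ord0 -> al n = 0 -> mon fsp fse al be s u i c = 0.
Proof.
move=> ns + aln; elim: s i c ns => [|m s IH] //= i c; rewrite inE /lop /fse.
have [<-|nm] /= := eqVneq n m.
  by move=> _ ->; rewrite eqxx andbF aln oppr0 !(mul0r, mulr0) addr0.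
move=> ns cn; rewrite IH // [X in _ + _ * X]IH ?upd_other //.
by rewrite !mulr0 addr0.
Qed.

Definition antisym (u : 'I_3 -> 'I_3 -> H -> C) :=
  forall i j c, i != ord0 -> j != ord0 -> u i j c = - u j i c.

Lemma antisym_diag u i c : antisym u -> i != ord0 -> u i i c = 0.
Proof.
move=> ua i0; have /eqP := ua i i c i0 i0.
by rewrite -addr_eq0 -mulr2n mulrn_eq0 /= => /eqP.
Qed.

Lemma odd_index (i j s : 'I_3) :
  i != ord0 -> j != ord0 -> s != ord0 -> i != j -> s = i \/ s = j.
Proof.
case: i j s => [i li] [j lj] [s ls]; rewrite -!val_eqE /= => i0 j0 s0 ij.
suff [e|e] : s = i \/ s = j by [left; apply: val_inj | right; apply: val_inj].
by move: i j s li lj ls i0 j0 s0 ij => [|[|[|i]]] [|[|[|j]]] [|[|[|s]]] //= *;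
  first [by left | by right].
Qed.

Variables (eta : C) (al : 'I_N -> C).
Local Notation L1 := (lop1 fsp fse al (fun=> eta)).
Local Notation L2 := (lop2 fsp fse (fun n => al n + eta) (fun=> eta)).
Local Notation M12 :=
  (mon12 fsp fse al (fun=> eta) (fun n => al n + eta) (fun=> eta)).

Definition flat_weight (c : H) n : C :=
  (al n + eta) * (al n - (c n != ord0)%:R * eta).

(** With two odd states, an antisymmetric pair of lines has a single independent component, so a
    site can only rescale it; the factor is the one-site quantum determinant. *)
Lemma flat_lop12_antisym n u i j c : antisym u -> i != ord0 -> j != ord0 ->
  L1 n (L2 n u) i j c = flat_weight c n * u i j c.
Proof.
move=> ua i0 j0; rewrite /lop1 /lop2 /lop /fsp /fse /flat_weight !upd_same !upd_upd.
rewrite i0 j0 /=; case: (eqVneq (c n) ord0) => [c0|c0] /=; first by ring.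
rewrite (ua _ i _ c0 i0).
have [ij|ij] := eqVneq i j.
  by rewrite -ij !(antisym_diag _ ua) // (ua _ _ _ c0 i0); ring.
have [e|e] := odd_index i0 j0 c0 ij.
  have ci : upd c n i = c by rewrite -e upd_id.
  by rewrite e ci (antisym_diag _ ua) //; ring.
have cj : upd c n j = c by rewrite -e upd_id.
rewrite e cj (antisym_diag (upd c n i) ua) //; ring.
Qed.

Lemma flat_mon12_antisym s u i j c : antisym u -> i != ord0 -> j != ord0 ->
  M12 s u i j c = (\prod_(n <- s) flat_weight c n) * u i j c.
Proof.
move=> ua; elim: s i j c => [|n s IH] i j c i0 j0; first by rewrite big_nil mul1r.
rewrite /= flat_lop12_antisym ?IH ?big_cons ?mulrA //.
by move=> i' j' c' i0' j0'; rewrite !IH // (ua i') // mulrN.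
Qed.

Lemma flat_lop12_range n u : al n = 0 -> antisym (L1 n (L2 n u)).
Proof.
move=> aln i j c i0 j0.
rewrite /lop1 /lop2 /lop /fsp /fse !upd_same !upd_upd i0 j0 aln /=.
by case: (eqVneq (c n) ord0) => _ /=; ring.
Qed.

Lemma flat_mon12_range a s u : a \in s -> al a = 0 -> antisym (M12 s u).
Proof.
move=> /splitPr[s1 s2] ala.
rewrite /mon12 foldr_cat -/(mon12 _ _ _ _ _ _ _ _) /=.
move=> i j c i0 j0; rewrite !flat_mon12_antisym //; try exact: flat_lop12_range.
by rewrite (flat_lop12_range _ ala) // mulrN.
Qed.

Variable (K : 'I_3 -> 'I_3 -> C).
Hypothesis K0r : forall i, K i ord0 = 0.
Let o1 : 'I_3 := lift ord0 ord0.
Let o2 : 'I_3 := lift ord0 (lift ord0 ord0).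

(** Site [a] projects the two lines onto antisymmetric states, so contracting the outputs with [K]
    leaves the 2x2 minors [k]. These are antisymmetric in the inputs too, hence all sites act on
    them by scalars. *)
Lemma flat_qdet a v c : al a = 0 ->
  transfer fsp fse K al (fun=> eta)
    (transfer fsp fse K (fun n => al n + eta) (fun=> eta) v) c
  = (K o1 o1 * K o2 o2 - K o1 o2 * K o2 o1) * (\prod_n flat_weight c n) * v c.
Proof.
move=> ala; rewrite transfer_comp12.
pose k i1 i2 := K i1 o1 * K i2 o2 - K i1 o2 * K i2 o1.
pose Z i1 i2 := M12 (sites N) (aux2 i1 i2 v).
have aS : a \in sites N by rewrite mem_rev mem_enum.
have Za i1 i2 : antisym (Z i1 i2) by exact: flat_mon12_range aS ala.
have inner i1 i2 : \sum_j1 \sum_j2 K i1 j1 * K i2 j2 * Z i1 i2 j1 j2 c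
  = k i1 i2 * Z i1 i2 o1 o2 c.
  rewrite !big_ord_recl !big_ord0 !K0r -/o1 -/o2.
  have [o10 o20] : o1 != ord0 /\ o2 != ord0 by [].
  rewrite (Za _ _ o2 o1 c o20 o10) (antisym_diag c (Za _ _) o10).
  rewrite (antisym_diag c (Za _ _) o20).
  by rewrite /k; ring.
transitivity (\sum_(p : 'I_3 * 'I_3) k p.1 p.2 * Z p.1 p.2 o1 o2 c).
  rewrite -(pair_bigA _ (fun i1 i2 => k i1 i2 * Z i1 i2 o1 o2 c)) /=.
  rewrite -(pair_bigA _ (fun i1 j1 => \sum_(q : 'I_3 * 'I_3)
      K i1 j1 * K q.1 q.2 * Z i1 q.1 j1 q.2 c)) /=.
  apply: eq_bigr => i1 _.
  under eq_bigr => j1 _ do rewrite -(pair_bigA _ (fun i2 j2 =>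
      K i1 j1 * K i2 j2 * Z i1 i2 j1 j2 c)) /=.
  by rewrite exchange_big; apply: eq_bigr => i2 _; rewrite -inner.
rewrite /Z -mon12_sum flat_mon12_antisym //.
  have -> : \prod_(n <- sites N) flat_weight c n = \prod_n flat_weight c n.
    by rewrite /sites (perm_big _ (permEl (perm_rev _))) big_enum.
  rewrite (bigD1 (o1, o2)) //= [X in _ * (_ + X)]big1 ?addr0; last first.
    move=> [i1 i2] /= ne; rewrite /aux2.
    have [e1|_] := eqVneq o1 i1; last by rewrite !(mul0r, mulr0).
    have [e2|_] := eqVneq o2 i2; last by rewrite !(mul0r, mulr0).
    by rewrite e1 e2 eqxx in ne.
  by rewrite /aux2 /= /k; ring.
move=> i j d _ _.
rewrite -sumrN [RHS](reindex_inj (h := fun p => (p.2, p.1))) /=; last first.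
  by move=> [? ?] [? ?] [-> ->].
by apply: eq_bigr => -[i1 i2] _ /=; rewrite /k /aux2; ring.
Qed.

Lemma flat_transfer_eq0 al' be' a v (c : H) : al' a = 0 -> c a = ord0 ->
  transfer fsp fse K al' be' v c = 0.
Proof.
move=> ala ca; rewrite /transfer big1 ?oppr0 // => p _.
by rewrite (@flat_mon_eq0 _ _ _ _ _ _ a) ?mulr0 // mem_rev mem_enum.
Qed.

Lemma flat_transfer_shape (chi : H -> C) al' be' v c :
  (forall n j (d : H), j != ord0 -> d n != ord0 -> chi (upd d n j) = chi d) ->
  transfer fsp fse K al' be' (fun d => chi d * v d) c
  = chi c * transfer fsp fse K al' be' v c.
Proof.
move=> chiP; rewrite /transfer mulrN mulr_sumr; congr (- _).
apply: eq_bigr => p _; rewrite mulrCA -flat_mon_shape //; congr (_ * mon _ _ _ _ _ _ _ _).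
by do 2!apply: functional_extensionality => ?; rewrite /aux1 mulrCA.
Qed.

End Flat.

(** * Triangularity *)

Section Triangular.
Variables (C : numClosedFieldType) (N : nat).
Local Notation H := (hconf N).

(** A linear substitute for the order on sets of positions. The weight of site [n] is [n.+1] because
    a [v_1] left there must count as much as one carried by the auxiliary line just past it.
    Different sets may share a weight; the flat operator keeps them apart. *)
Definition wt (c : H) : nat := (\sum_(n < N | c n == ord0) n.+1)%N.

Lemma wt_upd c (n : 'I_N) i :
  (wt (upd c n i) + (c n == ord0) * n.+1 = wt c + (i == ord0) * n.+1)%N.
Proof.
rewrite /wt big_mkcond [in RHS]big_mkcond /=.
rewrite (bigD1 n) //= [in RHS](bigD1 n) //= upd_same.
rewrite (eq_bigr (fun m : 'I_N => if c m == ord0 then m.+1 else 0%N)); last first.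
  by move=> m mn; rewrite upd_other.
by case: (c n == ord0) (i == ord0) => [] []; rewrite ?mul1n ?mul0n ?add0n ?addn0 // addnC.
Qed.

Variables (al be : 'I_N -> C) (i0 : 'I_3) (v : H -> C) (w : nat).
Hypothesis vw : forall c, (wt c < w)%N -> v c = 0.

Local Notation stage k := (rev (take k (enum 'I_N))).

(* An occupied v_1 in the auxiliary space at stage k counts for k, so that the
   total weight never decreases along the monodromy and it strictly increases
   as soon as the auxiliary space carries v_1 across a site. *)
Lemma mon_triangular k : (k <= N)%N ->
  (forall i c, (wt c + (i == ord0) * k < w)%N ->
     mon (@gsp C) (@gse C) al be (stage k) (aux1 i0 v) i c = 0) /\
  (forall i c, i != ord0 -> wt c = w ->
     mon (@gsp C) (@gse C) al be (stage k) (aux1 i0 v) i c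
     = mon (@fsp C) (@fse C) al be (stage k) (aux1 i0 v) i c).
Proof.
elim: k => [|k IH] kN.
  rewrite take0; split=> // i c; rewrite muln0 addn0 => /vw vc.
  by rewrite /= /aux1 vc mulr0.
have {IH}[Z E] := IH (ltnW kN).
pose n := Ordinal kN.
have -> : stage k.+1 = n :: stage k.
  rewrite (take_nth n) ?size_enum_ord // rev_rcons; congr (_ :: _).
  by apply: val_inj; rewrite /= nth_enum_ord.
split=> i c /=; rewrite {1}/lop.
  move=> lt; rewrite Z; last first.
    by apply: leq_ltn_trans lt; rewrite leq_add2l leq_mul2l leqnSn orbT.
  rewrite Z ?mulr0 ?addr0 //; apply: leq_ltn_trans lt.
  by rewrite -(wt_upd c n i) leq_add2l leq_mul2l leqnSn orbT.
move=> i1 wc; rewrite E // /lop; congr (_ + _).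
  by rewrite /gsp /fsp /deg i1 mulnC exprM sqrrN !expr1n.
have := wt_upd c n i; rewrite /gse /fse /deg i1 (negPf i1) mul0n addn0 wc /=.
have [-> we|c0 we] := eqVneq (c n) ord0.
  rewrite Z ?mulr0 ?oppr0 ?mulr0 ?mul0r // eqxx mul1n -we mul1n.
  by rewrite addnS.
by rewrite E // -we mul0n addn0.
Qed.

End Triangular.

Section TriangularTransfer.
Variables (C : numClosedFieldType) (N : nat).
Variable (K : 'I_3 -> 'I_3 -> C).
Hypothesis K0l : forall j, K ord0 j = 0.
Hypothesis K0r : forall i, K i ord0 = 0.

Lemma transfer_triangular (al be : 'I_N -> C) v w c :
  (forall c, (wt c < w)%N -> v c = 0) -> wt c = w ->
  transfer (@gsp C) (@gse C) K al be v c = transfer (@fsp C) (@fse C) K al be v c.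
Proof.
move=> vw wc; congr (- _); apply: eq_bigr => -[i j] _ /=.
have [->|i0] := eqVneq i ord0; first by rewrite K0l !mul0r.
have [->|j0] := eqVneq j ord0; first by rewrite K0r !mul0r.
have [_ E] := mon_triangular al be i vw (leqnn N).
congr (_ * _); have := E j c j0 wc.
by rewrite take_oversize // size_enum_ord.
Qed.

End TriangularTransfer.

(** * From graded operators to the vertex model *)

Section Bridge.
Variables (C : numClosedFieldType) (N : nat).
Local Notation H := (hconf N).

Lemma opapp_opmul (I : finType) (A B : op C I) v :
  opapp (opmul A B) v = opapp A (opapp B v).
Proof.
apply: functional_extensionality => c; rewrite /opapp /opmul.
under eq_bigr => d _ do rewrite mulr_suml.
rewrite exchange_big; apply: eq_bigr => e _; rewrite mulr_sumr.
by apply: eq_bigr => d _; rewrite mulrA.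
Qed.

Lemma opapp_opid (I : finType) (v : vec C I) : opapp (@opid C I) v = v.
Proof.
apply: functional_extensionality => c; rewrite /opapp /opid (bigD1 c) //= eqxx mul1r.
by rewrite big1 ?addr0 // => d dc; rewrite eq_sym (negPf dc) mul0r.
Qed.

Lemma opapp_foldr (I : finType) (T : Type) (F : T -> op C I) s v :
  opapp (foldr (fun m acc => opmul (F m) acc) (@opid C I) s) v
  = foldr (fun m w => opapp (F m) w) v s.
Proof. by elim: s => [|m s IH] /=; rewrite ?opapp_opid // opapp_opmul IH. Qed.

Definition htail (e : sconf N) : H := [ffun m => e (lift ord0 m)].

Lemma ext0 i (c : H) : ext i c ord0 = i.
Proof. by rewrite ffunE unlift_none. Qed.

Lemma extS i (c : H) m : ext i c (lift ord0 m) = c m.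
Proof. by rewrite ffunE liftK. Qed.

Lemma ext_htail (e : sconf N) : ext (e ord0) (htail e) = e.
Proof.
by apply/ffunP => k; case: (unliftP ord0 k) => [m ->|->]; rewrite ?extS ?ext0 // ffunE.
Qed.

Lemma htail_ext i c : htail (ext i c) = c.
Proof. by apply/ffunP => m; rewrite ffunE extS. Qed.

Lemma sum_sconf (F : sconf N -> C) :
  \sum_e F e = \sum_i \sum_(d : H) F (ext i d).
Proof.
rewrite pair_bigA /= (reindex (fun p : 'I_3 * H => ext p.1 p.2)) //.
exists (fun e : sconf N => (e ord0, htail e)) => [[i c] _ | e _] /=.
  by rewrite ext0 htail_ext.
by rewrite ext_htail.
Qed.

Definition setk (k : 'I_N.+1) (i : 'I_3) (d : sconf N) : sconf N :=
  [ffun m => if m == k then i else d m].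

Lemma opmul_emb (A : op C (sconf N)) k i j c d :
  opmul A (emb C k i j) c d = if d k == j then A c (setk k i d) *
     (-1) ^+ ((deg i + deg j) * \sum_(m < N.+1 | (m < k)%N) deg (d m))%N else 0.
Proof.
rewrite /opmul (bigD1 (setk k i d)) //= {1}/emb eqxx andbT.
rewrite [X in _ + X]big1 => [|e ne]; last by rewrite /emb -/(setk k i d) (negPf ne) andbF mulr0.
by case: ifP; rewrite ?mulr0 addr0.
Qed.

Lemma emb0E i j (c : H) (e : sconf N) b :
  emb C ord0 i j (ext b c) e = ((b == i) && (e == ext j c))%:R.
Proof.
rewrite /emb big_pred0 // muln0 expr0.
case: (eqVneq b i) => [->|bi] /=; last first.
  case: andP => // -[_ /eqP/(congr1 (fun f : sconf N => f ord0))].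
  by rewrite ext0 ffunE eqxx => /eqP; rewrite (negPf bi).
case: (eqVneq e (ext j c)) => [->|ne] /=.
  rewrite ext0 eqxx /= -/(setk ord0 i (ext j c)).
  suff -> : setk ord0 i (ext j c) = ext i c by rewrite eqxx.
  by apply/ffunP => k; case: (unliftP ord0 k) => [m ->|->];
     rewrite [LHS]ffunE ?eqxx ?extS ?ext0.
case: andP => // -[/eqP ej /eqP E]; case/eqP: ne; rewrite -(ext_htail e) ej.
congr (ext _ _); rewrite -(htail_ext i c) E; apply/ffunP => m.
by rewrite !ffunE.
Qed.

(** Of the nine terms only the one matching the auxiliary state and the state of the site survives;
    the string counts the odd states at the sites before [n]. *)
Lemma opapp_Pperm (n : 'I_N) U b (c : H) :
  opapp (Pperm C (lift ord0 n)) U (ext b c)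
  = (-1) ^+ (deg b * deg (c n)
             + (deg b + deg (c n)) * \sum_(m < N | (m < n)%N) deg (c m))%N
    * U (ext (c n) (upd c n b)).
Proof.
have PE d : Pperm C (lift ord0 n) (ext b c) d
  = (d == ext (c n) (upd c n b))%:R *
    (-1) ^+ (deg (c n) + (deg (c n) + deg b) *
       \sum_(m < N.+1 | (m < lift ord0 n)%N) deg (d m))%N.
  rewrite /Pperm (bigD1 b) //= [X in _ + X]big1 ?addr0; last first.
    move=> a ab; apply: big1 => b' _; rewrite opmul_emb emb0E.
    by rewrite [b == a]eq_sym (negPf ab) /= mul0r; case: ifP; rewrite mulr0.
  rewrite (bigD1 (c n)) //= [X in _ + X]big1 ?addr0; last first.
    move=> b' bn; rewrite opmul_emb emb0E eqxx /=.
    case: ifP => [/eqP dn|]; last by rewrite mulr0.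
    case: eqP => [E|]; last by rewrite mul0r mulr0.
    have := congr1 (fun f : sconf N => f (lift ord0 n)) E.
    by rewrite extS ffunE eqxx => b'c; rewrite b'c eqxx in bn.
  rewrite opmul_emb emb0E eqxx /=.
  have -> : (d == ext (c n) (upd c n b)) =
     (d (lift ord0 n) == b) && (setk (lift ord0 n) (c n) d == ext (c n) c).
    apply/eqP/andP => [->|[/eqP dn /eqP E]].
      rewrite extS upd_same; split=> //; apply/eqP/ffunP => k.
      rewrite [LHS]ffunE; case: (unliftP ord0 k) => [m ->|->]; last by rewrite !ext0.
      rewrite !extS (inj_eq lift_inj); case: (eqVneq m n) => [->|mn] //.
      by rewrite upd_other.
    apply/ffunP => k; have := congr1 (fun f : sconf N => f k) E.
    rewrite /= ffunE; case: (unliftP ord0 k) => [m ->|->]; last by rewrite !ext0.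
    rewrite !extS (inj_eq lift_inj); case: (eqVneq m n) => [->|mn] //.
      by rewrite upd_same.
    by rewrite upd_other.
  case: ifP => //= _; rewrite ?(mul0r, mulr0) //.
  by case: (_ == _); rewrite ?mul1r ?mul0r ?mulr0 // exprD.
rewrite /opapp (bigD1 (ext (c n) (upd c n b))) //= [X in _ + X]big1 => [|d ne]; last first.
  by rewrite PE (negPf ne) !mul0r.
rewrite PE eqxx mul1r addr0; congr (_ * _).
rewrite big_mkcond big_ord_recl /= ext0 -big_mkcond /=.
under eq_bigr do rewrite extS.
under eq_bigl do rewrite ltnS.
rewrite (eq_bigr (fun m => deg (c m))) => [|m mn]; last first.
  by rewrite upd_other // neq_ltn mn.
move: (\sum_(_ < _ | _) _)%N => S.
rewrite /deg; case: (c n == ord0); case: (b == ord0) => /=;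
rewrite ?(mul0n, mul1n, addn0, add0n, expr0, mulnDl) //; rewrite !exprD; ring.
Qed.

Lemma opapp_Rop (eta mu : C) (n : 'I_N) U b (c : H) :
  opapp (Rop eta mu (lift ord0 n)) U (ext b c)
  = mu * U (ext b c) + eta * ((-1) ^+ (deg b * deg (c n)
             + (deg b + deg (c n)) * \sum_(m < N | (m < n)%N) deg (c m))%N
    * U (ext (c n) (upd c n b))).
Proof.
rewrite -opapp_Pperm -[X in mu * X](congr1 (fun f => f (ext b c)) (opapp_opid U)).
rewrite /opapp !mulr_sumr -big_split; apply: eq_bigr => d _.
by rewrite /Rop /opid /= mulrDl !mulrA.
Qed.

Definition tau (k : nat) (c : H) : nat := (\sum_(m < N | (m < k)%N) deg (c m))%N.

Lemma tauS (n : 'I_N) c : tau n.+1 c = (tau n c + deg (c n))%N.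
Proof.
rewrite /tau (bigD1 n) //= addnC; congr (_ + _)%N; apply: eq_bigl => m.
by rewrite ltnS [RHS]ltn_neqAle andbC.
Qed.

Lemma tau_upd (n : 'I_N) c i : tau n (upd c n i) = tau n c.
Proof. by apply: eq_bigr => m mn; rewrite upd_other // neq_ltn mn. Qed.

(* The first sign moves the auxiliary space back across the sites already
   visited; the inner one prepares the parity sign of the supertrace. *)
Lemma foldr_Rop eta (al : 'I_N -> C) U k b (c : H) : (k <= N)%N ->
  foldr (fun m w => opapp (Rop eta (al m) (lift ord0 m)) w) U
     (rev (take k (enum 'I_N))) (ext b c)
  = (-1) ^+ (deg b * tau k c)%N
    * mon (@gsp C) (@gse C) al (fun=> eta) (rev (take k (enum 'I_N)))
        (fun i d => (-1) ^+ tau k d * U (ext i d)) b c.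
Proof.
elim: k b c => [|k IH] b c kN.
  by rewrite take0 /= /tau !big_pred0_eq muln0 !expr0 !mul1r.
pose n := Ordinal kN.
have nk : rev (take k.+1 (enum 'I_N)) = n :: rev (take k (enum 'I_N)).
  rewrite (take_nth n) ?size_enum_ord // rev_rcons; congr (_ :: _).
  by apply: val_inj; rewrite /= nth_enum_ord.
have nin : n \notin rev (take k (enum 'I_N)).
  have : uniq (rev (take k.+1 (enum 'I_N))) by rewrite rev_uniq take_uniq ?enum_uniq.
  by rewrite nk /= => /andP[].
rewrite nk /= opapp_Rop !IH ?(ltnW kN) //.
pose X := mon (@gsp C) (@gse C) al (fun=> eta) (rev (take k (enum 'I_N)))
        (fun i d => (-1) ^+ tau k d * U (ext i d)).
(* Site [n] is not yet visited, so its share of the string sign commutes with the partial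
   monodromy. *)
have XE i d : mon (@gsp C) (@gse C) al (fun=> eta) (rev (take k (enum 'I_N)))
        (fun i d => (-1) ^+ tau k.+1 d * U (ext i d)) i d
   = (-1) ^+ deg (d n) * X i d.
  rewrite /X -(mon_local _ _ _ _ (fun s => (-1) ^+ deg s)) //.
  congr (mon _ _ _ _ _ _ _ _); do 2!apply: functional_extensionality => ?.
  by rewrite (tauS n) exprD; ring.
rewrite /lop !XE -/X (tau_upd n) (tauS n) upd_same /=.
rewrite -/(tau n c) /= /gsp /gse.
move: (X b c) (X (c n) _) (tau k c) => x y t.
rewrite /deg; case: (c n == ord0); case: (b == ord0) => /=;
rewrite ?(mul0n, mul1n, addn0, add0n, expr0, mulnDl) ?exprD -?(signr_odd _ t);
case: (odd t) => /=; ring.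
Qed.

Lemma opapp_T1 K (eta : C) (xi : 'I_N -> C) lam v c :
  (forall j, K ord0 j = 0) -> (forall i, K i ord0 = 0) ->
  opapp (T1 K eta xi lam) v c
  = transfer (@gsp C) (@gse C) K (fun n => lam - xi n) (fun=> eta) v c.
Proof.
move=> K0l K0r; set Rs := foldr (fun m acc => opmul (Rop eta (lam - xi m) (lift ord0 m)) acc)
  (@opid C (sconf N)) (rev (enum 'I_N)).
have KE i (d : H) : monodromy K eta xi lam (ext i c) (ext i d)
  = \sum_b K i b * Rs (ext b c) (ext i d).
  rewrite /monodromy -/Rs /opmul /Kop.
  under eq_bigr => e _ do rewrite mulr_suml.
  rewrite exchange_big (bigD1 i) //= [X in _ + X]big1 ?addr0; last first.
    move=> a ai; apply: big1 => e _; rewrite big1 ?mul0r // => b _.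
    by rewrite emb0E eq_sym (negPf ai) mulr0.
  under eq_bigr => e _ do rewrite mulr_suml.
  rewrite exchange_big; apply: eq_bigr => b _ /=.
  rewrite (bigD1 (ext b c)) //= [X in _ + X]big1 => [|e ne]; first by rewrite emb0E !eqxx mulr1 addr0.
  by rewrite emb0E (negPf ne) andbF mulr0 mul0r.
(* The column part of the supertrace sign is absorbed into the vector, where it cancels the full
   string sign [tau N]. *)
pose p (d : H) : C := (-1) ^+ parity d.
have RE i b : \sum_d Rs (ext b c) (ext i d) * (p d * v d)
  = (-1) ^+ (deg b * parity c)%N *
    mon (@gsp C) (@gse C) (fun n => lam - xi n) (fun=> eta) (sites N) (aux1 i v) b c.
  transitivity (opapp Rs (fun e : sconf N => (e ord0 == i)%:R * (p (htail e) * v (htail e))) (ext b c)).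
    rewrite /opapp sum_sconf (bigD1 i) //= [X in _ + X]big1 ?addr0; last first.
      move=> j ji; apply: big1 => d _; rewrite ext0 (negPf ji) mul0r mulr0 //.
    by apply: eq_bigr => d _; rewrite ext0 htail_ext eqxx mul1r.
  have tN d : tau N d = parity d by apply: eq_bigl => m; rewrite ltn_ord.
  rewrite /Rs opapp_foldr.
  have := foldr_Rop eta (fun n => lam - xi n) (fun e : sconf N => (e ord0 == i)%:R *
     (p (htail e) * v (htail e))) b c (leqnn N).
  rewrite take_oversize ?size_enum_ord // => ->; rewrite tN /sites.
  congr (_ * mon _ _ _ _ _ _ _ _); do 2!apply: functional_extensionality => ?.
  rewrite tN ext0 htail_ext /aux1 /p mulrCA; congr (_ * _).
  by rewrite mulrA -exprD addnn -mul2n exprM sqrrN !expr1n mul1r.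
rewrite /transfer -(pair_bigA _ (fun i j => K i j * mon _ _ _ _ _ (aux1 i v) j c)) /=.
rewrite /opapp /T1 /str0.
etransitivity; first by apply: eq_bigr => d _; apply: mulr_suml.
rewrite exchange_big -sumrN; apply: eq_bigr => i _ /=.
have [->|i0] := eqVneq i ord0.
  rewrite !big1 ?oppr0 // => [j|d] _; rewrite ?K0l ?mul0r // KE big1 ?mulr0 ?mul0r //.
  by move=> b _; rewrite K0l mul0r.
rewrite -sumrN.
transitivity (\sum_b - (-1) ^+ parity c * K i b *
   \sum_d Rs (ext b c) (ext i d) * (p d * v d)).
  under eq_bigr => d _ do rewrite KE mulr_sumr mulr_suml.
  rewrite exchange_big; apply: eq_bigr => b _; rewrite mulr_sumr.
  apply: eq_bigr => d _ /=.
  rewrite /deg i0 mul1n exprD expr1 exprD /p; ring.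
apply: eq_bigr => b _; rewrite RE.
have [->|b0] := eqVneq b ord0; first by rewrite K0r !(mulr0, mul0r) oppr0.
rewrite /deg b0 mul1n.
have : (-1) ^+ parity c * (-1) ^+ parity c = 1 :> C.
  by rewrite -exprD addnn -mul2n exprM sqrrN !expr1n.
move: ((-1) ^+ parity c) => s ss; rewrite -[RHS]mul1r -ss; ring.
Qed.

End Bridge.

(** * Interpolation and the cubic system *)

Section PolyDeg.
Variable C : numClosedFieldType.

(** The coefficient [l] of degree [n] may be zero, which lets terms of lower degree be added
    freely. *)
Definition polydeg (n : nat) (l : C) (f : C -> C) : Prop :=
  exists p : {poly C}, [/\ (size p <= n.+1)%N, p`_n = l & forall x, f x = p.[x]].

Lemma polydeg_ext n l f g : (forall x, f x = g x) -> polydeg n l f -> polydeg n l g.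
Proof. by move=> fg [p [sp pn pE]]; exists p; split=> // x; rewrite -fg. Qed.

Lemma polydegD n l l' f g : polydeg n l f -> polydeg n l' g ->
  polydeg n (l + l') (fun x => f x + g x).
Proof.
move=> [p [sp pn pE]] [q [sq qn qE]]; exists (p + q); split.
- by rewrite (leq_trans (size_polyD _ _)) // geq_max sp.
- by rewrite coefD pn qn.
- by move=> x; rewrite hornerD pE qE.
Qed.

Lemma polydegZ n l a f : polydeg n l f -> polydeg n (a * l) (fun x => a * f x).
Proof.
move=> [p [sp pn pE]]; exists (a *: p); split.
- exact: leq_trans (size_scale_leq _ _) sp.
- by rewrite coefZ pn.
- by move=> x; rewrite hornerZ pE.
Qed.

Lemma polydegS n l f : polydeg n l f -> polydeg n.+1 0 f.
Proof.
move=> [p [sp pn pE]]; exists p; split=> //; first exact: leqW.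
by rewrite nth_default.
Qed.

Lemma polydegXB n l z f : polydeg n l f -> polydeg n.+1 l (fun x => (x - z) * f x).
Proof.
move=> [p [sp pn pE]]; exists (('X - z%:P) * p); split.
- by rewrite (leq_trans (size_polyMleq _ _)) // size_XsubC.
- by rewrite mulrBl coefB coefXM coefCM /= pn nth_default // mulr0 subr0.
- by move=> x; rewrite hornerM !hornerE pE.
Qed.

Lemma polydeg0 n : polydeg n 0 (fun=> 0).
Proof. by exists 0; split; rewrite ?size_poly0 ?coef0 // => x; rewrite horner0. Qed.

Lemma polydeg1 : polydeg 0 1 (fun=> 1).
Proof. by exists 1; split; rewrite ?size_poly1 ?coef1 // => x; rewrite hornerC. Qed.

Lemma polydeg_sum n (J : finType) (l : J -> C) (f : J -> C -> C) :
  (forall j, polydeg n (l j) (f j)) ->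
  polydeg n (\sum_j l j) (fun x => \sum_j f j x).
Proof.
move=> fP; rewrite unlock; elim: (index_enum J) => [|j s IH] /=.
  exact: polydeg0.
exact: polydegD.
Qed.

Lemma polydeg_prod (I : finType) (A : pred I) (z : I -> C) :
  polydeg #|A| 1 (fun x => \prod_(b in A) (x - z b)).
Proof.
apply: (@polydeg_ext _ _ (fun x => \prod_(b <- enum A) (x - z b))) => [x|].
  exact: big_enum.
rewrite cardE; elim: (enum A) => [|b s IH] /=.
  by apply: polydeg_ext polydeg1 => x; rewrite big_nil.
by apply: polydeg_ext (polydegXB (z b) IH) => x; rewrite big_cons.
Qed.

(** With equal top coefficients the difference has degree below [n], so [n] nodes suffice instead of
    [n + 1]. *)
Lemma polydeg_unique n l f g (z : 'I_n -> C) : injective z ->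
  polydeg n l f -> polydeg n l g -> (forall b, f (z b) = g (z b)) ->
  forall x, f x = g x.
Proof.
move=> zi [p [sp pn pE]] [q [sq qn qE]] fg x.
suff : p - q == 0 by rewrite subr_eq0 pE qE => /eqP->.
apply: contraT => pq0.
have : (size (codom z) < size (p - q)%R)%N.
  apply: max_poly_roots pq0 _ _; last by rewrite map_inj_uniq ?enum_uniq.
  apply/allP => _ /codomP[b ->].
  by rewrite /root hornerD hornerN -pE -qE fg subrr.
rewrite size_codom card_ord ltnNge => /negP[].
have s1 : (size (p - q)%R <= n.+1)%N.
  by rewrite (leq_trans (size_polyD _ _)) // geq_max sp size_polyN.
apply/leq_sizeP => j; rewrite leq_eqVlt => /orP[/eqP<-|nj].
  by rewrite coefB pn qn subrr.
exact/(leq_sizeP _ _ s1).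
Qed.

End PolyDeg.

Section Lagrange.
Variables (C : numClosedFieldType) (N : nat).

Definition lag (z : 'I_N -> C) (a : 'I_N) (lam : C) : C :=
  \prod_(b < N | b != a) ((lam - z b) / (z a - z b)).

Lemma polydeg_dfun (z : 'I_N -> C) : polydeg N 1 (dfun z).
Proof.
have := polydeg_prod (I := 'I_N) predT z; rewrite card_ord.
exact: polydeg_ext.
Qed.

Lemma polydeg_lag (z : 'I_N -> C) a : polydeg N 0 (lag z a).
Proof.
have := polydeg_prod (predC1 a) z; rewrite cardC1 card_ord => P.
suff : polydeg N.-1.+1 0 (lag z a).
  by rewrite prednK // (leq_ltn_trans _ (ltn_ord a)).
apply: polydeg_ext (polydegS (polydegZ (\prod_(b | b != a) (z a - z b)^-1) P)) => x.
by rewrite /lag -big_split /=; apply: eq_bigr => b _; rewrite mulrC.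
Qed.

Lemma lag_node (z : 'I_N -> C) a b : injective z -> lag z a (z b) = (a == b)%:R.
Proof.
move=> zi; rewrite /lag; case: eqVneq => [->|ab] /=.
  by apply: big1 => c cb; rewrite divff // subr_eq0 (inj_eq zi) eq_sym.
by rewrite (bigD1 b) 1?eq_sym //= subrr !mul0r.
Qed.

Lemma dfun_node (z : 'I_N -> C) b : dfun z (z b) = 0.
Proof. by rewrite /dfun (bigD1 b) //= subrr mul0r. Qed.

Lemma sum_lag_node (z y : 'I_N -> C) b : injective z ->
  \sum_a lag z a (z b) * y a = y b.
Proof.
move=> zi; rewrite (bigD1 b) //= lag_node // eqxx mul1r big1 ?addr0 // => a ab.
by rewrite lag_node // (negPf ab) mul0r.
Qed.

Lemma polydeg_interp (z y : 'I_N -> C) l :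
  polydeg N l (fun lam => l * dfun z lam + \sum_a lag z a lam * y a).
Proof.
rewrite -[l in polydeg _ l _]addr0 -{1}[l]mulr1.
apply: polydegD; first exact/polydegZ/polydeg_dfun.
have := polydeg_sum (fun a => polydegZ (y a) (polydeg_lag z a)).
rewrite big1 => [|a _]; last exact: mulr0.
by apply: polydeg_ext => lam; apply: eq_bigr => a _; rewrite mulrC.
Qed.

Lemma interp (z : 'I_N -> C) l f lam : injective z -> polydeg N l f ->
  f lam = l * dfun z lam + \sum_a lag z a lam * f (z a).
Proof.
move=> zi fP; apply: (polydeg_unique zi fP (polydeg_interp z (fun a => f (z a)) l)) => b.
by rewrite dfun_node mulr0 add0r (sum_lag_node (fun a => f (z a))).
Qed.

Lemma fm1E eta (xi : 'I_N -> C) a lam : fm 1 eta xi a lam = lag xi a lam.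
Proof. by rewrite /fm [X in _ * X]big1 ?mulr1 // => b _; rewrite big_geq. Qed.

Lemma t1xE k2 k3 eta (xi x : 'I_N -> C) lam :
  t1x k2 k3 eta xi x lam = - (k2 + k3) * dfun xi lam + \sum_a lag xi a lam * x a.
Proof. by rewrite /t1x; under eq_bigr do rewrite fm1E. Qed.

Lemma polydeg_t1x k2 k3 eta (xi x : 'I_N -> C) :
  polydeg N (- (k2 + k3)) (t1x k2 k3 eta xi x).
Proof.
by apply: polydeg_ext (polydeg_interp xi x (- (k2 + k3))) => lam; rewrite t1xE.
Qed.

Lemma t1x_node k2 k3 eta (xi x : 'I_N -> C) a : injective xi ->
  t1x k2 k3 eta xi x (xi a) = x a.
Proof. by move=> xii; rewrite t1xE dfun_node mulr0 add0r sum_lag_node. Qed.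

End Lagrange.

Section Nodes.
Variables (C : numClosedFieldType) (N : nat) (eta : C) (xi : 'I_N -> C).
Hypothesis eta0 : eta != 0.
Hypothesis gen : forall a b : 'I_N, a != b ->
  forall z : int, xi a - xi b != z%:~R * eta.

Lemma gen_inj : injective xi.
Proof.
move=> a b ab; apply/eqP; apply: contraT => /gen/(_ 0).
by rewrite ab subrr mul0r eqxx.
Qed.

Definition node (A : pred 'I_N) (n : 'I_N) : C := if A n then xi n else xi n + eta.

Lemma node_inj A : injective (node A).
Proof.
move=> a b; rewrite /node => E; apply/eqP; apply: contraT => /gen G.
have := G 0; have := G 1; have := G (-1); rewrite mulrN1z mul1r ?mulN1r.
case: (A a) (A b) E => [] [] E; rewrite ?mul0r ?mul1r.
- by rewrite E subrr eqxx.
- by rewrite E addrAC subrr add0r eqxx.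
- by rewrite -E opprD addrA subrr sub0r eqxx.
- by rewrite (addIr _ E) subrr eqxx.
Qed.

Lemma dfun_shift_neq0 b : dfun xi (xi b + eta) != 0.
Proof.
apply/prodf_neq0 => n _; have [->|bn] := eqVneq b n; first by rewrite addrAC subrr add0r.
have := gen bn (-1); rewrite mulrN1z mulN1r; apply: contra_neq => E.
by apply/eqP; rewrite -addr_eq0 addrAC E.
Qed.

Variables (k2 k3 : C) (x : 'I_N -> C).
Local Notation t := (t1x k2 k3 eta xi x).

(** The bracket of the cubic system as a function of [lam]. By [fused_node] it is the fused
    eigenvalue with the factor [d(lam + eta)] removed; [f^(2)] supplies that division at the nodes
    [xi_r]. *)
Definition fused (lam : C) : C := k2 * k3 * dfun xi lam
   + \sum_(r < N) fm 2 eta xi r lam * t (xi r + eta) * x r.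

Lemma fusedE lam : fused lam = k2 * k3 * dfun xi lam + \sum_r lag xi r lam *
   ((dfun xi (xi r + eta))^-1 * t (xi r + eta) * x r).
Proof.
congr (_ + _); apply: eq_bigr => r _; rewrite !mulrA; congr (_ * _ * _ * _).
rewrite /dfun -prodfV; apply: eq_bigr => b _; rewrite big_nat1 mul1r.
by congr (_^-1); ring.
Qed.

Lemma polydeg_fused : polydeg N (k2 * k3) fused.
Proof.
exact: polydeg_ext (fun lam => esym (fusedE lam)) (polydeg_interp _ _ _).
Qed.

Lemma fused_node b : dfun xi (xi b + eta) * fused (xi b) = x b * t (xi b + eta).
Proof.
rewrite fusedE dfun_node mulr0 add0r (sum_lag_node (fun r => _ * _ * _)); last exact: gen_inj.
by rewrite !mulrA divff ?dfun_shift_neq0 // mul1r mulrC.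
Qed.

Definition fusion_rel (A : pred 'I_N) := forall b,
  x b * t (xi b + eta) = k2 * k3 * dfun xi (xi b + eta) * dfun (node A) (xi b).

Lemma fusion_relP A : fusion_rel A <->
  forall lam, fused lam = k2 * k3 * dfun (node A) lam.
Proof.
split=> [R lam|E b]; last by rewrite -fused_node E; ring.
have P : polydeg N (k2 * k3) (fun lam => k2 * k3 * dfun (node A) lam).
  rewrite -{1}[k2 * k3]mulr1; exact/polydegZ/polydeg_dfun.
apply: (polydeg_unique gen_inj polydeg_fused P) => b.
apply: (mulfI (dfun_shift_neq0 b)); rewrite fused_node R; ring.
Qed.

Lemma inS_of_fusion (A : pred 'I_N) : (forall a, A a -> x a = 0) -> fusion_rel A ->
  inS k2 k3 eta xi x.
Proof.
move=> xA /fusion_relP E a; rewrite -/(fused (xi a + eta)) E.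
have [/xA->|nA] := boolP (A a); first by rewrite mul0r.
suff -> : xi a + eta = node A a by rewrite dfun_node !mulr0.
by rewrite /node (negPf nA).
Qed.

(** [fused] vanishes at every node: at [xi_b + eta] by the cubic equation if [x_b] is nonzero, and
    at [xi_b] by [fused_node] if [x_b = 0]. Its roots and top coefficient then determine it. *)
Lemma fusion_of_inS : inS k2 k3 eta xi x -> fusion_rel (fun a => x a == 0).
Proof.
set A := fun a => _; move=> xS; apply/fusion_relP.
have P : polydeg N (k2 * k3) (fun lam => k2 * k3 * dfun (node A) lam).
  rewrite -{1}[k2 * k3]mulr1; exact/polydegZ/polydeg_dfun.
apply: (polydeg_unique (@node_inj A) polydeg_fused P) => b.
rewrite dfun_node mulr0 /node; case: ifP => [/eqP xb|xb].
  by apply: (mulfI (dfun_shift_neq0 b)); rewrite fused_node xb mul0r mulr0.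
have /eqP := xS b; rewrite -/(fused (xi b + eta)) mulf_eq0.
by rewrite -/(A b) xb => /eqP.
Qed.

End Nodes.

(** * Eigenvalues and solutions *)

Lemma det_mx22 (R : comNzRingType) (A : 'M[R]_2) :
  \det A = A ord0 ord0 * A (lift ord0 ord0) (lift ord0 ord0)
          - A ord0 (lift ord0 ord0) * A (lift ord0 ord0) ord0.
Proof.
have e : lift (lift ord0 ord0) 0 = ord0 :> 'I_2 by apply: val_inj.
rewrite (expand_det_row _ ord0) !big_ord_recl big_ord0 addr0 /cofactor.
by rewrite !det_mx11 !mxE e /= expr0 mul1r expr1 mulN1r mulrN.
Qed.

Section Twist.
Variables (C : numClosedFieldType) (K2 : 'M[C]_2) (k2 k3 : C).
Let K := Khat K2.
Let o1 : 'I_3 := lift ord0 ord0.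
Let o2 : 'I_3 := lift ord0 (lift ord0 ord0).

Lemma Khat0l j : K ord0 j = 0.
Proof. by rewrite /K /Khat unlift_none. Qed.

Lemma Khat0r i : K i ord0 = 0.
Proof. by rewrite /K /Khat unlift_none; case: unlift. Qed.

Lemma KhatS a b : K (lift ord0 a) (lift ord0 b) = K2 a b.
Proof. by rewrite /K /Khat !liftK. Qed.

Hypothesis K2diag : exists2 P : 'M[C]_2, P \in unitmx &
   K2 = invmx P *m diag_mx (\row_i [:: k2; k3]`_i) *m P.

Lemma Khat_tr : \sum_i K i i = k2 + k3.
Proof.
have [P Pu E] := K2diag.
have -> : \sum_i K i i = \tr K2.
  rewrite big_ord_recl Khat0l add0r /mxtrace.
  by apply: eq_bigr => i _; rewrite KhatS.
rewrite E mxtrace_mulC mulmxA mulmxV // mul1mx mxtrace_diag.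
by rewrite !big_ord_recl big_ord0 !mxE /= addr0.
Qed.

Lemma Khat_det : K o1 o1 * K o2 o2 - K o1 o2 * K o2 o1 = k2 * k3.
Proof.
have [P Pu E] := K2diag.
transitivity (\det K2).
  by rewrite det_mx22 !KhatS.
rewrite E !det_mulmx mulrAC -det_mulmx mulVmx // det1 mul1r det_diag.
by rewrite !big_ord_recl big_ord0 !mxE /= mulr1.
Qed.

End Twist.

Section TransferPoly.
Variables (C : numClosedFieldType) (N : nat) (eta : C) (xi : 'I_N -> C).
Variable (K : 'I_3 -> 'I_3 -> C).
Hypothesis K0r : forall i, K i ord0 = 0.

(** For an odd auxiliary state the passing sign is 1, which gives the leading coefficient; the twist
    discards the even outputs. *)
Lemma mon_polydeg s u i (c : hconf N) : exists l,
  polydeg (size s) l (fun lam =>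
     mon (@gsp C) (@gse C) (fun n => lam - xi n) (fun=> eta) s u i c)
  /\ (i != ord0 -> l = u i c).
Proof.
elim: s i c => [|n s IH] i c /=.
  exists (u i c); split=> //; exists (u i c)%:P; split.
  - exact: size_polyC_leq1.
  - by rewrite coefC.
  - by move=> x; rewrite hornerC.
have [l1 [P1 E1]] := IH i c; have [l2 [P2 _]] := IH (c n) (upd c n i).
exists (gsp C i (c n) * l1 + eta * gse C i (c n) * 0); split; last first.
  move=> i0; rewrite mulr0 addr0 E1 // /gsp /deg i0 mulnC exprM sqrrN !expr1n.
  exact: mul1r.
apply: polydeg_ext (polydegD (polydegZ (gsp C i (c n)) (polydegXB (xi n) P1))
  (polydegZ (eta * gse C i (c n)) (polydegS P2))) => lam.
by rewrite /lop mulrCA mulrA.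
Qed.

Lemma transfer_polydeg v (c : hconf N) :
  polydeg N (- (\sum_i K i i) * v c) (fun lam =>
     transfer (@gsp C) (@gse C) K (fun n => lam - xi n) (fun=> eta) v c).
Proof.
have term (p : 'I_3 * 'I_3) : polydeg N (K p.1 p.2 * aux1 p.1 v p.2 c) (fun lam =>
   K p.1 p.2 * mon (@gsp C) (@gse C) (fun n => lam - xi n) (fun=> eta) (sites N)
      (aux1 p.1 v) p.2 c).
  have [p0|p0] := eqVneq p.2 ord0.
    by rewrite p0 K0r mul0r; apply: polydeg_ext (polydeg0 C N) => x; rewrite mul0r.
  have [l [P E]] := mon_polydeg (sites N) (aux1 p.1 v) p.2 c.
  rewrite -E //; apply: polydegZ; move: P.
  by rewrite /sites size_rev size_enum_ord.
have := polydegZ (-1) (polydeg_sum term).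
have -> : -1 * \sum_(p : 'I_3 * 'I_3) K p.1 p.2 * aux1 p.1 v p.2 c
   = - (\sum_i K i i) * v c.
  rewrite mulN1r mulNr; congr (- _); rewrite mulr_suml.
  rewrite -(pair_bigA _ (fun i j => K i j * aux1 i v j c)) /=.
  apply: eq_bigr => i _; rewrite (bigD1 i) //= /aux1 eqxx mul1r big1 ?addr0 //.
  by move=> j ji; rewrite (negPf ji) mul0r mulr0.
by apply: polydeg_ext => lam; rewrite mulN1r.
Qed.

End TransferPoly.

Section EigenvalueInS.
Variables (C : numClosedFieldType) (N : nat) (eta : C) (xi : 'I_N -> C).
Hypothesis eta0 : eta != 0.
Hypothesis gen : forall a b : 'I_N, a != b ->
  forall z : int, xi a - xi b != z%:~R * eta.
Variables (K2 : 'M[C]_2) (k2 k3 : C).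
Hypothesis K2diag : exists2 P : 'M[C]_2, P \in unitmx &
   K2 = invmx P *m diag_mx (\row_i [:: k2; k3]`_i) *m P.
Let K := Khat K2.
Local Notation T := (T1 (Khat K2) eta xi).
Local Notation G lam :=
  (transfer (@gsp C) (@gse C) K (fun n => lam - xi n) (fun=> eta)).
Local Notation Fl lam :=
  (transfer (@fsp C) (@fse C) K (fun n => lam - xi n) (fun=> eta)).

Lemma opapp_T1_Khat lam v c : opapp (T lam) v c = G lam v c.
Proof. by apply: opapp_T1 => ?; rewrite ?Khat0l ?Khat0r. Qed.

Lemma T1_interp lam v c : opapp (T lam) v c =
  - (k2 + k3) * dfun xi lam * v c + \sum_a lag xi a lam * opapp (T (xi a)) v c.
Proof.
have := transfer_polydeg eta xi (Khat0r K2) v c; rewrite (Khat_tr K2diag) => P.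
rewrite opapp_T1_Khat (interp lam (gen_inj gen) P).
congr (_ + _); first by ring.
by apply: eq_bigr => a _; rewrite opapp_T1_Khat.
Qed.

Lemma T1_eigen x v : (forall a c, opapp (T (xi a)) v c = x a * v c) ->
  forall lam c, opapp (T lam) v c = t1x k2 k3 eta xi x lam * v c.
Proof.
move=> E lam c; rewrite T1_interp t1xE mulrDl; congr (_ + _).
by rewrite mulr_suml; apply: eq_bigr => a _; rewrite E mulrA.
Qed.

Lemma eigenvalue_t1x t : is_eigenvalue T t ->
  forall lam, t lam = t1x k2 k3 eta xi (fun a => t (xi a)) lam.
Proof.
move=> [v [[c vc] E]] lam; apply: (mulIf vc); rewrite -E.
by apply: (T1_eigen (x := fun a => t (xi a))) => a d; rewrite E.
Qed.

(** The lowest-weight part of an eigenvector, restricted to one set of [v_1] positions, is an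
    eigenvector of the flat transfer matrix with the same eigenvalue. The vanishing on A and the
    quantum determinant then apply to it. *)
Lemma eigenvalue_inS t : is_eigenvalue T t ->
  inS k2 k3 eta xi (fun a => t (xi a)).
Proof.
move=> tE; have tx := eigenvalue_t1x tE; move: tE => [v [[c0 vc0] E]].
pose d := [arg min_(d < c0 | v d != 0) wt d].
have [vd dmin] : v d != 0 /\ forall e, v e != 0 -> (wt d <= wt e)%N.
  by rewrite /d; case: arg_minnP => // e ve emin; split.
pose A : pred 'I_N := fun n => d n == ord0.
pose sh (e : hconf N) := [forall n, (e n == ord0) == A n].
pose v' e := (sh e)%:R * v e.
have shU n j (e : hconf N) : j != ord0 -> e n != ord0 ->
    (sh (upd e n j))%:R = (sh e)%:R :> C.
  move=> j0 en; congr ((nat_of_bool _)%:R); apply: eq_forallb => m.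
  have [->|mn] := eqVneq m n; first by rewrite upd_same (negPf j0) (negPf en).
  by rewrite upd_other.
have vw e : (wt e < wt d)%N -> v e = 0.
  by move=> lt; apply/eqP; apply: contraTT lt => /dmin; rewrite -leqNgt.
have FE lam : Fl lam v' = fun e => t lam * v' e.
  apply: functional_extensionality => e.
  rewrite /v' flat_transfer_shape // mulrCA.
  have [se|] := boolP (sh e); last by rewrite !mul0r.
  (* Configurations of the same shape as [d] have the same weight, which is minimal on the support
     of [v]. *)
  congr (_ * _); rewrite -E opapp_T1_Khat; apply/esym.
  apply: transfer_triangular vw _; [exact: Khat0l | exact: Khat0r |].
  by apply: eq_bigl => n; have /eqP-> := forallP se n.
have shd : sh d by apply/forallP => n.
have v'd : v' d != 0 by rewrite /v' shd mul1r.
apply: (inS_of_fusion eta0 gen (A := A)) => [a Aa|b].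
  apply: (mulIf v'd); rewrite mul0r.
  have -> : t (xi a) * v' d = Fl (xi a) v' d by rewrite FE.
  by apply: (@flat_transfer_eq0 _ _ _ _ _ a); [exact: subrr | exact/eqP].
rewrite -tx; apply: (mulIf v'd).
have := flat_qdet eta (al := fun n => xi b - xi n) (Khat0r K2) v' d (subrr (xi b)).
rewrite (Khat_det K2diag).
have -> : (fun n => xi b - xi n + eta) = (fun n => xi b + eta - xi n).
  by apply: functional_extensionality => n; ring.
rewrite -/K FE transferZ FE mulrCA mulrA => ->; congr (_ * _); rewrite -[RHS]mulrA; congr (_ * _).
rewrite /dfun -big_split; apply: eq_bigr => n _; rewrite /flat_weight /node /A /=.
congr (_ * _); first by ring.
by case: (d n == ord0) => /=; ring.
Qed.

End EigenvalueInS.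

(** * Linear separation of the solutions of the cubic system *)

Section Counting.
Variables (C : numClosedFieldType) (N : nat) (eta : C) (xi : 'I_N -> C).
Hypothesis eta0 : eta != 0.
Hypothesis gen : forall a b : 'I_N, a != b ->
  forall z : int, xi a - xi b != z%:~R * eta.
Variables (k2 k3 : C) (J : finType) (y : J -> 'I_N -> C).
Hypothesis yS : forall j, inS k2 k3 eta xi (y j).
Hypothesis y_inj : forall i j, (forall a, y i a = y j a) -> i = j.

(** The letters of [c] encode the pair (A, B): 0 for A, 2 for B, 1 for neither. This is why there
    are exactly as many functions as configurations. *)
Definition phi (c : hconf N) (x : 'I_N -> C) : C :=
  [forall a, (x a == 0) == (c a == ord0)]%:R * \prod_a x a ^+ (c a == ord_max).

Variable al : J -> C.
Hypothesis al0 : forall c, \sum_j al j * phi c (y j) = 0.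

Section Shape.
Variable A : pred 'I_N.
Let P j := [forall a, (y j a == 0) == A a].
Let mono (h : {ffun 'I_N -> bool}) j := \prod_a y j a ^+ h a.

(** Testing against every squarefree monomial, not only the constant one, is what makes the
    condition stable under multiplication by [y j a]. *)
Definition annihilated (g : J -> C) :=
  forall h : {ffun 'I_N -> bool}, \sum_(j | P j) al j * mono h j * g j = 0.

Lemma annihilated1 : annihilated (fun=> 1).
Proof.
move=> h; have [/existsP[a /andP[Aa ha]]|] := boolP [exists a, A a && h a].
  apply: big1 => j /forallP/(_ a)/eqP; rewrite Aa => /eqP ya.
  by rewrite /mono (bigD1 a) //= ya ha expr1 mul0r !(mulr0, mul0r).
rewrite negb_exists => /forallP Ah.
pose c : hconf N := [ffun a => if A a then ord0 else if h a then ord_max else inord 1].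
rewrite -[RHS](al0 c) big_mkcond; apply: eq_bigr => j _.
have cA a : (c a == ord0) = A a.
  by rewrite ffunE; case: (A a) (h a) => [] [] //; apply/eqP => /(congr1 val); rewrite /= inordK.
have ch a : (c a == ord_max) = h a.
  have := Ah a; rewrite ffunE; case: (A a) (h a) => [] [] // _.
  by apply/eqP => /(congr1 val); rewrite /= inordK.
rewrite /phi; have -> : [forall a, (y j a == 0) == (c a == ord0)] = P j.
  by apply: eq_forallb => a; rewrite cA.
case: (P j); last by rewrite mul0r mulr0.
by rewrite mulr1 mul1r; congr (_ * _); apply: eq_bigr => a _; rewrite ch.
Qed.

(** Writes [y j a] as [t(xi_a)] and interpolates [t] at nodes adapted to [h]: each value [t(z_b)]
    toggles the factor [x_b] in the monomial. *)
Lemma annihilated_mul a g : annihilated g -> annihilated (fun j => y j a * g j).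
Proof.
move=> gA h; pose B : pred 'I_N := fun n => A n || ~~ h n.
pose flip b : {ffun 'I_N -> bool} := [ffun n => if n == b then ~~ h b else h n].
(* Cost of the toggle: zero on A, the constant of the fusion relation when [x_b] is removed, 1 when
   it is added. *)
pose kap b := if A b then 0 else if h b then
   k2 * k3 * dfun xi (xi b + eta) * dfun (node eta xi A) (xi b) else 1.
pose z := node eta xi B.
have flipE b j : mono (flip b) j = y j b ^+ (~~ h b) * \prod_(n | n != b) y j n ^+ h n.
  rewrite /mono (bigD1 b) //= ffunE eqxx; congr (_ * _); apply: eq_bigr => n nb.
  by rewrite ffunE (negPf nb).
have monoE b j : mono h j = y j b ^+ h b * \prod_(n | n != b) y j n ^+ h n.
  by rewrite /mono (bigD1 b).
have key j : P j -> mono h j * y j a = - (k2 + k3) * dfun z (xi a) * mono h j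
   + \sum_b lag z b (xi a) * kap b * mono (flip b) j.
  move=> /forallP Pj; pose t := t1x k2 k3 eta xi (y j).
  have -> : y j a = t (xi a) by rewrite /t t1x_node; last exact: (gen_inj gen).
  rewrite /t (interp _ (@node_inj _ _ _ _ gen B) (polydeg_t1x k2 k3 eta xi (y j))).
  rewrite mulrDr mulr_sumr; congr (_ + _); first by rewrite -/z; ring.
  apply: eq_bigr => b _; rewrite mulrCA -mulrA; congr (_ * _).
  rewrite (monoE b) flipE /kap -/t -/z /z /node /B.
  have [Ab|nA] /= := boolP (A b).
    rewrite /t t1x_node; last exact: (gen_inj gen).
    by have := Pj b; rewrite Ab => /eqP/eqP->; rewrite mulr0 mul0r.
  have [hb|hb] /= := boolP (h b); last first.
    rewrite /t t1x_node; last exact: (gen_inj gen).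
    by rewrite expr0 expr1 !mul1r mulrC.
  have := fusion_of_inS eta0 gen (yS j) b; rewrite -/t.
  have -> : dfun (node eta xi (fun a0 => y j a0 == 0)) (xi b) = dfun (node eta xi A) (xi b).
    by apply: eq_bigr => n _; rewrite /node; have /eqP-> := Pj n.
  by move=> <-; rewrite expr0 expr1; ring.
transitivity (\sum_(j | P j) (- (k2 + k3) * dfun z (xi a) * (al j * mono h j * g j)
   + \sum_b lag z b (xi a) * kap b * (al j * mono (flip b) j * g j))).
  apply: eq_bigr => j Pj.
  transitivity (al j * g j * (mono h j * y j a)); first by ring.
  rewrite key // mulrDr mulr_sumr; congr (_ + _); first by ring.
  by apply: eq_bigr => b _; ring.
rewrite big_split /= -mulr_sumr gA mulr0 add0r exchange_big big1 // => b _ /=.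
by rewrite -mulr_sumr gA mulr0.
Qed.

Lemma annihilatedB g g' s : annihilated g -> annihilated g' ->
  annihilated (fun j => g j - s * g' j).
Proof.
move=> gA gA' h; transitivity (\sum_(j | P j) al j * mono h j * g j
   - s * \sum_(j | P j) al j * mono h j * g' j); last by rewrite gA gA' mulr0 subr0.
by rewrite mulr_sumr -sumrB; apply: eq_bigr => j _; ring.
Qed.

End Shape.

(** The product of the [fac i] vanishes at each solution other than [y j0] and not at [y j0], so the
    annihilated relation reduces to its single term [al j0]. *)
Lemma phi_free j0 : al j0 = 0.
Proof.
pose A : pred 'I_N := fun a => y j0 a == 0.
pose fac i j := if [pick a | y j0 a != y i a] is Some a then y j a - y i a else 1.
have facA s : annihilated A (fun j => \prod_(i <- s) fac i j).
  elim: s => [|i s IH] h.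
    by rewrite -[RHS](annihilated1 A h); apply: eq_bigr => j _; rewrite big_nil.
  pose a := [pick a | y j0 a != y i a].
  pose G j := \prod_(k <- s) fac k j.
  suff R : annihilated A (fun j => (if a is Some a' then y j a' - y i a' else 1) * G j).
    by rewrite -[RHS](R h); apply: eq_bigr => j _; rewrite big_cons.
  case: a => [a|] h'.
    rewrite -[RHS](annihilatedB (y i a) (annihilated_mul a IH) IH h').
    by apply: eq_bigr => j _; rewrite mulrBl.
  by rewrite -[RHS](IH h'); apply: eq_bigr => j _; rewrite mul1r.
have fac0 i : i != j0 -> fac i j0 != 0 /\ fac i i = 0.
  rewrite /fac; case: pickP => [a ya ij|none /eqP[]]; first by rewrite subr_eq0 subrr.
  by apply: y_inj => a; have /negbFE/eqP := none a.
have := facA (enum (predC1 j0)) [ffun=> false].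
rewrite (bigD1 j0) /=; last by apply/forallP.
rewrite [X in _ + X]big1 ?addr0 => [|j /andP[_ jj0]]; last first.
  rewrite (big_rem j) ?mem_enum //= (fac0 j jj0).2 mul0r mulr0 //.
rewrite big1 => [|a _]; last by rewrite ffunE.
rewrite mulr1 => /eqP; rewrite mulf_eq0 => /orP[/eqP//|].
rewrite prodf_seq_eq0 => /hasP[i]; rewrite mem_enum => ij.
by rewrite (negPf (fac0 i ij).1) andbF.
Qed.
End Counting.

Section SolutionCount.
Variables (C : numClosedFieldType) (N : nat) (eta : C) (xi : 'I_N -> C).
Hypothesis eta0 : eta != 0.
Hypothesis gen : forall a b : 'I_N, a != b ->
  forall z : int, xi a - xi b != z%:~R * eta.
Variables (k2 k3 : C).

Lemma card_solutions (J : finType) (y : J -> 'I_N -> C) :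
  (forall j, inS k2 k3 eta xi (y j)) ->
  (forall i j, (forall a, y i a = y j a) -> i = j) -> (#|J| <= #|hconf N|)%N.
Proof.
move=> yS yi; rewrite leqNgt; apply/negP => lt.
pose M := \matrix_(i < #|J|, c < #|hconf N|) phi (enum_val c) (y (enum_val i)).
have /rowV0Pn[u /sub_kermxP uM u0] : kermx M != 0.
  rewrite -mxrank_eq0 mxrank_ker -lt0n subn_gt0.
  exact: leq_ltn_trans (rank_leq_col _) lt.
pose al j := u 0 (enum_rank j).
have al0 c : \sum_j al j * phi c (y j) = 0.
  have := congr1 (fun A : 'rV_ _ => A 0 (enum_rank c)) uM; rewrite !mxE => E; rewrite -[RHS]E.
  rewrite (reindex _ (onW_bij _ (@enum_val_bij J))) /=.
  by apply: eq_bigr => i _; rewrite mxE enum_rankK /al enum_valK.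
case/eqP: u0; apply/rowP => i; rewrite mxE -(enum_valK i).
exact: (phi_free eta0 gen yS yi al0).
Qed.

Lemma solutions_complete (y : hconf N -> 'I_N -> C) x :
  (forall h, inS k2 k3 eta xi (y h)) ->
  (forall h h', (forall a, y h a = y h' a) -> h = h') ->
  inS k2 k3 eta xi x -> exists h, forall a, y h a = x a.
Proof.
move=> yS yi xS.
have [/existsP[h /forallP E]|] := boolP [exists h, [forall a, y h a == x a]].
  by exists h => a; apply/eqP.
rewrite negb_exists => /forallP none.
have ne h : ~ (forall a, y h a = x a).
  by move=> E; case/negP: (none h); apply/forallP => a; rewrite E.
(* A solution missing from the list would give one more than the bound allows; [None] indexes it. *)
have : (#|{: option (hconf N)}| <= #|hconf N|)%N; last by rewrite card_option ltnn.
apply: (@card_solutions _ (fun o => if o is Some h then y h else x)).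
  by case=> [h|].
case=> [h|] [h'|] // E; first by rewrite (yi h h').
  by case: (ne h).
by case: (ne h') => a; rewrite E.
Qed.

End SolutionCount.

(** * Simple spectrum as a polynomial condition *)

(** Allows rewriting under the argument binder: [g] is left as an existential variable and fixed by
    the pointwise rewriting. *)
Lemma class_ext (X R : Type) (P : (X -> R) -> Prop) f g : f =1 g -> P g -> P f.
Proof. by move=> /functional_extensionality->. Qed.

Section RingClass.
Variables (X : Type) (R : comNzRingType) (P : (X -> R) -> Prop).

(** Abstracts what determinants and transfer matrices need from polynomiality, so that one closure
    proof serves polynomials in [u], in [xi], in the covector, and coefficientwise. *)
Definition ring_class := [/\ forall a, P (fun=> a),
  forall f g, P f -> P g -> P (fun x => f x + g x) &
  forall f g, P f -> P g -> P (fun x => f x * g x)].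

Hypothesis Pcl : ring_class.

Lemma class_const a : P (fun=> a). Proof. by case: Pcl. Qed.

Lemma classD f g : P f -> P g -> P (fun x => f x + g x).
Proof. by case: Pcl => _ + _; apply. Qed.

Lemma classM f g : P f -> P g -> P (fun x => f x * g x).
Proof. by case: Pcl => _ _; apply. Qed.

Lemma classN f : P f -> P (fun x => - f x).
Proof.
move=> Pf; have := classM (class_const (-1)) Pf.
by apply: class_ext => x; rewrite mulN1r.
Qed.

Lemma class_sum (I : Type) (s : seq I) (Q : pred I) (f : I -> X -> R) :
  (forall i, P (f i)) -> P (fun x => \sum_(i <- s | Q i) f i x).
Proof.
move=> Pf; elim: s => [|i s IH].
  by eapply class_ext; [move=> x; rewrite big_nil; reflexivity | apply: class_const].
eapply class_ext; first by move=> x; rewrite big_cons; reflexivity.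
by case: (Q i) => //; apply: classD.
Qed.

Lemma class_prod (I : Type) (s : seq I) (Q : pred I) (f : I -> X -> R) :
  (forall i, P (f i)) -> P (fun x => \prod_(i <- s | Q i) f i x).
Proof.
move=> Pf; elim: s => [|i s IH].
  by eapply class_ext; [move=> x; rewrite big_nil; reflexivity | apply: class_const].
eapply class_ext; first by move=> x; rewrite big_cons; reflexivity.
by case: (Q i) => //; apply: classM.
Qed.

Lemma class_det n (A : X -> 'M[R]_n) :
  (forall i j, P (fun x => A x i j)) -> P (fun x => \det (A x)).
Proof.
move=> PA; apply: class_sum => s; apply: classM; first exact: class_const.
by apply: class_prod => i.
Qed.

End RingClass.

Section SimpleSpectrum.
Variable C : numClosedFieldType.

Lemma char_poly_conj n (P A : 'M[C]_n) : P \in unitmx ->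
  char_poly (invmx P *m A *m P) = char_poly A.
Proof.
move=> Pu; rewrite /char_poly.
have -> : char_poly_mx (invmx P *m A *m P)
  = map_mx polyC (invmx P) *m char_poly_mx A *m map_mx polyC P.
  rewrite /char_poly_mx mulmxBr mulmxBl !map_mxM; congr (_ - _).
  rewrite scalar_mxC -mulmxA -map_mxM mulVmx // map_mx1.
  exact/esym/mulmx1.
by rewrite !det_mulmx mulrAC -det_mulmx -map_mxM mulVmx // map_mx1 det1 mul1r.
Qed.

Lemma eigen_horner n (A : 'M[C]_n.+1) (v : 'rV_n.+1) z p :
  v *m A = z *: v -> v *m horner_mx A p = p.[z] *: v.
Proof.
move=> vA; elim/poly_ind: p => [|p c IH].
  by rewrite rmorph0 horner0 mulmx0 scale0r.
rewrite rmorphD rmorphM /= horner_mx_X horner_mx_C mulmxDr.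
rewrite [_ *m (_ * _)]mulmxA IH -scalemxAl vA mul_mx_scalar !hornerE.
by rewrite scalerA -scalerDl.
Qed.

Lemma root_deriv_prod (s : seq C) : ~~ uniq s ->
  exists2 z, z \in s & root (\prod_(x <- s) ('X - x%:P))^`() z.
Proof.
elim: s => //= x s IH; rewrite negb_and negbK big_cons derivM derivXsubC mul1r.
have rz z : z \in s -> root (\prod_(y <- s) ('X - y%:P)) z by rewrite root_prod_XsubC.
have [xs _|xs /= /IH[z zs z0]] := boolP (x \in s).
  exists x; first exact: mem_head.
  by rewrite /root !hornerE (eqP (rz x xs)) subrr mul0r addr0.
exists z; first by rewrite inE zs orbT.
by rewrite /root !hornerE (eqP (rz z zs)) (eqP z0) mulr0 addr0.
Qed.

(* Up to sign, the discriminant of the characteristic polynomial. *)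
Definition cert n (A : 'M[C]_n.+1) : C := \det (horner_mx A (char_poly A)^`()).

Definition simple_spec n (A : 'M[C]_n) := exists2 P : 'M[C]_n, P \in unitmx &
  exists2 d : 'rV[C]_n, injective (d 0) & A = invmx P *m diag_mx d *m P.

Lemma cert_conj n (P : 'M[C]_n.+1) d : P \in unitmx ->
  cert (invmx P *m diag_mx d *m P)
  = \prod_i (\prod_j ('X - (d 0 j)%:P))^`().[d 0 i].
Proof.
move=> Pu; rewrite /cert horner_mx_uconjC // char_poly_conj //.
rewrite !det_mulmx mulrAC -det_mulmx mulVmx // det1 mul1r horner_mx_diag det_diag.
rewrite char_poly_trig ?diag_mx_is_trig //; apply: eq_bigr => i _.
rewrite mxE; congr ((deriv _).[_]); apply: eq_bigr => j _.
by rewrite mxE eqxx.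
Qed.

(** At a repeated root [z] of the characteristic polynomial, an eigenvector for [z] lies in the
    kernel of its derivative evaluated at [A]. With distinct roots the minimal polynomial splits
    simply, so [A] is diagonalizable. *)
Lemma certP n (A : 'M[C]_n.+1) : cert A != 0 <-> simple_spec A.
Proof.
split=> [cA|[P Pu [d di ->]]]; last first.
  rewrite cert_conj //; apply/prodf_neq0 => i _.
  rewrite (bigD1 i) //= derivM derivXsubC mul1r !hornerE subrr mul0r addr0.
  rewrite horner_prod; apply/prodf_neq0 => j ji.
  by rewrite hornerXsubC subr_eq0 (inj_eq di) eq_sym.
have [r chE] := closed_field_poly_normal (char_poly A).
rewrite (monicP (char_poly_monic A)) scale1r in chE.
have ur : uniq r.
  apply: contraNT cA => /root_deriv_prod[z zr z0].
  have /eigenvalueP[v vA v0] : eigenvalue A z.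
    by rewrite eigenvalue_root_char chE root_prod_XsubC.
  apply/det0P; exists v => //.
  by rewrite (eigen_horner _ vA) chE (eqP z0) scale0r.
have [P Pu /diagonalizable_forPex[d /(simmxLR Pu)]] : diagonalizable A.
  by apply/diagonalizableP; exists r => //; rewrite -chE mxminpoly_dvd_char.
rewrite mxpoly.conjVmx // => AE; exists P => //; exists d => //.
move: cA; rewrite AE cert_conj // => cA i j dij; apply/eqP.
apply: contraNT cA => ij.
have : ~~ uniq (codom (d 0)) by apply: contra ij => /injectiveP/(_ _ _ dij)->.
move=> /root_deriv_prod[z /codomP[k ->]]; rewrite big_map big_enum /= => /eqP k0.
by apply/eqP; rewrite (bigD1 k) //= k0 mul0r.
Qed.

Lemma simple_specZ n (A : 'M[C]_n) k : k != 0 ->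
  simple_spec A -> simple_spec (k *: A).
Proof.
move=> k0 [P Pu [d di ->]]; exists P => //; exists (k *: d).
  by move=> i j; rewrite !mxE => /(mulfI k0)/di.
rewrite scalemxAl scalemxAr; congr (_ *m _ *m _).
by apply/matrixP => i j; rewrite !mxE mulrnAr.
Qed.

Variables (X : Type) (P : (X -> C) -> Prop).
Hypothesis Pcl : ring_class P.

Definition coef_class (f : X -> {poly C}) := forall k, P (fun x => (f x)`_k).

Lemma coef_class_ring : ring_class coef_class.
Proof.
split=> [a k|f g Pf Pg k|f g Pf Pg k]; first exact: class_const.
  by eapply class_ext; [move=> x; rewrite coefD; reflexivity | apply: classD].
eapply class_ext; first by move=> x; rewrite coefM; reflexivity.
by apply: class_sum => // i; apply: classM.
Qed.

Lemma class_char_poly n (A : X -> 'M[C]_n) : (forall i j, P (fun x => A x i j)) ->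
  coef_class (fun x => char_poly (A x)).
Proof.
move=> PA; apply: (class_det coef_class_ring) => i j.
eapply class_ext; first by move=> x; rewrite !mxE; reflexivity.
apply: (classD coef_class_ring); first exact: (class_const coef_class_ring).
apply: (classN coef_class_ring) => k.
eapply class_ext; first by move=> x; rewrite coefC; reflexivity.
by case: (k == 0%N) => //; apply: class_const.
Qed.

Lemma class_exp n (A : X -> 'M[C]_n.+1) k : (forall i j, P (fun x => A x i j)) ->
  forall i j, P (fun x => (A x ^+ k) i j).
Proof.
move=> PA; elim: k => [|k IH] i j.
  by eapply class_ext; [move=> x; rewrite expr0 mxE; reflexivity | apply: class_const].
eapply class_ext; first by move=> x; rewrite exprS mxE; reflexivity.
by apply: class_sum => // l; apply: classM.
Qed.

Lemma class_cert n (A : X -> 'M[C]_n.+1) : (forall i j, P (fun x => A x i j)) ->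
  P (fun x => cert (A x)).
Proof.
move=> PA; apply: (class_det Pcl) => i j.
have hE x : horner_mx (A x) (char_poly (A x))^`() i j
  = \sum_(k < n.+1) (char_poly (A x))`_k.+1 * k.+1%:R * (A x ^+ k) i j.
  have sz : (size (char_poly (A x))^`() <= n.+1)%N.
    by rewrite -ltnS -[n.+2](size_char_poly (A x)) lt_size_deriv // monic_neq0 ?char_poly_monic.
  have -> : (char_poly (A x))^`() = \poly_(k < n.+1) (char_poly (A x))^`()`_k.
    apply/polyP => k; rewrite coef_poly; case: ltnP => // nk.
    by rewrite nth_default // (leq_trans sz).
  rewrite poly_def rmorph_sum summxE; apply: eq_bigr => k _ /=.
  by rewrite linearZ rmorphXn /= horner_mx_X mxE coef_deriv mulr_natr.
eapply class_ext; first by move=> x; rewrite hE; reflexivity.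
apply: (class_sum Pcl) => k; apply: (classM Pcl); last exact: class_exp.
by apply: (classM Pcl); [exact: class_char_poly | exact: (class_const Pcl)].
Qed.

End SimpleSpectrum.

(** * Polynomial dependence on the parameters *)

Section PolynomialFunctions.
Variable C : numClosedFieldType.

Definition polyfun (f : C -> C) := exists p : {poly C}, forall x, f x = p.[x].

Lemma polyfun_ring : ring_class polyfun.
Proof.
split=> [a|f g [p pE] [q qE]|f g [p pE] [q qE]].
- by exists a%:P => x; rewrite hornerC.
- by exists (p + q) => x; rewrite hornerD pE qE.
- by exists (p * q) => x; rewrite hornerM pE qE.
Qed.

Lemma polyfun_id : polyfun id.
Proof. by exists 'X => x; rewrite hornerX. Qed.

(** The root 0 is excluded because the curve [b / u] needs [u] nonzero. *)
Lemma poly_nonroot (p : {poly C}) : p != 0 -> exists2 x, x != 0 & p.[x] != 0.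
Proof.
move=> p0; have /closed_nonrootP[x] : 'X * p != 0 by rewrite mulf_neq0 ?polyX_eq0.
by rewrite rootM rootX negb_or => /andP[x0 px]; exists x.
Qed.

Lemma polyfun_nonroot f : polyfun f -> f 0 != 0 -> exists2 x, x != 0 & f x != 0.
Proof.
move=> [p pE] f0; have [|x x0 px] := @poly_nonroot p.
  by apply: contraNneq f0 => p0; rewrite pE p0 horner0.
by exists x => //; rewrite pE.
Qed.

Variable I : finType.

Definition mpolyfun (f : (I -> C) -> C) :=
  exists p : seq (C * (I -> nat)), forall x, mpeval p x = f x.

Lemma mpolyfun_ring : ring_class mpolyfun.
Proof.
split=> [a|f g [p pE] [q qE]|f g [p pE] [q qE]].
- exists [:: (a, fun=> 0%N)] => x; rewrite /mpeval big_seq1 /=.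
  by rewrite big1 ?mulr1.
- by exists (p ++ q) => x; rewrite -pE -qE /mpeval big_cat.
exists [seq (m.1 * m'.1, fun i => (m.2 i + m'.2 i)%N) | m <- p, m' <- q] => x.
rewrite -pE -qE /mpeval big_allpairs_dep mulr_suml; apply: eq_bigr => m _.
rewrite mulr_sumr; apply: eq_bigr => m' _ /=.
under eq_bigr do rewrite exprD.
by rewrite big_split /=; ring.
Qed.

Lemma mpolyfun_coord i : mpolyfun (fun x => x i).
Proof.
exists [:: (1, fun j => (j == i) : nat)] => x; rewrite /mpeval big_seq1 /= mul1r.
by rewrite (bigD1 i) //= eqxx big1 ?mulr1 // => j /negPf->.
Qed.

End PolynomialFunctions.

(** * The separated covectors for general families of operators *)

Section Covectors.
Variables (C : numClosedFieldType) (N : nat).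
Local Notation H := (hconf N).

Definition cov (O : 'I_N -> op C H) (S : vec C H) (h : H) (v : vec C H) : C :=
  \sum_c S c * (foldr (fun n w => iter (h n) (opapp (O n)) w) v (enum 'I_N)) c.

Lemma covhE T xi S h v : covh T xi S h v = cov (fun n => T (xi n)) S h v.
Proof. by []. Qed.

Lemma opappZ (O : op C H) k v : opapp O (fun c => k * v c) = fun c => k * opapp O v c.
Proof.
apply: functional_extensionality => c; rewrite /opapp mulr_sumr.
by apply: eq_bigr => d _; rewrite mulrCA.
Qed.

Lemma opapp_sum (O : op C H) (J : finType) (k : J -> C) v :
  opapp O (fun c => \sum_j k j * v j c) = fun c => \sum_j k j * opapp O (v j) c.
Proof.
apply: functional_extensionality => c; rewrite /opapp.
under eq_bigr do rewrite mulr_sumr.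
rewrite exchange_big; apply: eq_bigr => j _; rewrite mulr_sumr.
by apply: eq_bigr => d _; rewrite mulrCA.
Qed.

Lemma opapp_unitvec (O : op C H) d c : opapp O (unitvec C d) c = O c d.
Proof.
rewrite /opapp (bigD1 d) //= /unitvec eqxx mulr1 big1 ?addr0 // => e /negPf ed.
by rewrite ed mulr0.
Qed.

Lemma unitvec_sum (v : vec C H) : v = fun c => \sum_d v d * unitvec C d c.
Proof.
apply: functional_extensionality => c.
rewrite (bigD1 c) //= /unitvec eqxx mulr1 big1 ?addr0 // => d dc.
by rewrite eq_sym (negPf dc) mulr0.
Qed.

Lemma cov_linear O S h v : cov O S h v = \sum_d cov O S h (unitvec C d) * v d.
Proof.
pose F w := foldr (fun n w => iter (h n) (opapp (O n)) w) w (enum 'I_N).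
have FE : F v = fun c => \sum_d v d * F (unitvec C d) c.
  rewrite /F {1}[v]unitvec_sum; elim: (enum 'I_N) => //= n s ->.
  elim: (nat_of_ord (h n)) => //= k ->; exact: opapp_sum.
rewrite /cov -/(F v) FE; under eq_bigr do rewrite mulr_sumr.
rewrite exchange_big; apply: eq_bigr => d _ /=; rewrite mulr_suml.
by apply: eq_bigr => c _; rewrite -/(F _); ring.
Qed.

Lemma cov_scale (s : 'I_N -> C) O S h v :
  cov (fun n c d => s n * O n c d) S h v = (\prod_n s n ^+ h n) * cov O S h v.
Proof.
have sE n w : opapp (fun c d => s n * O n c d) w = fun c => s n * opapp (O n) w c.
  apply: functional_extensionality => c; rewrite /opapp mulr_sumr.
  by apply: eq_bigr => d _; rewrite mulrA.
rewrite /cov -[\prod_n _](big_enum _ _ predT) mulr_sumr.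
set F := foldr _ _ _; set F' := foldr _ _ _.
suff -> : F = fun c => (\prod_(n <- enum 'I_N) s n ^+ h n) * F' c.
  by apply: eq_bigr => c _; rewrite mulrCA.
rewrite /F /F'; elim: (enum 'I_N) => /= [|n l ->].
  by apply: functional_extensionality => c; rewrite big_nil mul1r.
rewrite big_cons; elim: (nat_of_ord (h n)) => /= [|k ->].
  by rewrite expr0 mul1r.
by rewrite sE opappZ; apply: functional_extensionality => c; rewrite exprS; ring.
Qed.

Lemma cov_eigen (x : 'I_N -> C) O S h v :
  (forall n c, opapp (O n) v c = x n * v c) ->
  cov O S h v = (\prod_n x n ^+ h n) * \sum_c S c * v c.
Proof.
move=> E; rewrite /cov -[\prod_n _](big_enum _ _ predT) mulr_sumr.
set F := foldr _ _ _.
suff -> : F = fun c => (\prod_(n <- enum 'I_N) x n ^+ h n) * v c.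
  by apply: eq_bigr => c _; rewrite mulrCA.
rewrite /F; elim: (enum 'I_N) => /= [|n l ->].
  by apply: functional_extensionality => c; rewrite big_nil mul1r.
rewrite big_cons; elim: (nat_of_ord (h n)) => /= [|k ->].
  by rewrite expr0 mul1r.
by rewrite opappZ; apply: functional_extensionality => c; rewrite E exprS; ring.
Qed.

Variables (X : Type) (P : (X -> C) -> Prop).
Hypothesis Pcl : ring_class P.

Lemma class_cov (O : X -> 'I_N -> op C H) (S v : X -> vec C H) h :
  (forall n c d, P (fun x => O x n c d)) -> (forall c, P (fun x => S x c)) ->
  (forall c, P (fun x => v x c)) -> P (fun x => cov (O x) (S x) h (v x)).
Proof.
move=> PO PS Pv; apply: class_sum => // c; apply: classM => //; move: c.
elim: (enum 'I_N) => //= n s IH.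
elim: (nat_of_ord (h n)) => //= k IHk c.
by apply: class_sum => // d; apply: classM.
Qed.

Lemma class_mon sp se (al be : X -> 'I_N -> C) s (u : X -> 'I_3 -> H -> C) :
  (forall n, P (fun x => al x n)) -> (forall n, P (fun x => be x n)) ->
  (forall i c, P (fun x => u x i c)) ->
  forall i c, P (fun x => mon sp se (al x) (be x) s (u x) i c).
Proof.
move=> Pa Pb Pu; elim: s => //= n s IH i c.
apply: classD => //; do 2?[apply: classM => //]; exact: class_const.
Qed.

Lemma class_transfer sp se K (al be : X -> 'I_N -> C) (v : X -> vec C H) c :
  (forall n, P (fun x => al x n)) -> (forall n, P (fun x => be x n)) ->
  (forall c, P (fun x => v x c)) ->
  P (fun x => transfer sp se K (al x) (be x) (v x) c).
Proof.
move=> Pa Pb Pv; apply: classN => //; apply: class_sum => // p.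
apply: classM => //; first exact: class_const.
apply: (@class_mon sp se al be (sites N) (fun x => aux1 p.1 (v x))) => // i d.
by apply: classM => //; exact: class_const.
Qed.

End Covectors.

(** * Rescaled transfer matrices and their limit *)

Section BasePoint.
Variables (C : numClosedFieldType) (N : nat) (eta : C).
Local Notation H := (hconf N).
Variable (K : 'I_3 -> 'I_3 -> C).
Hypothesis K0l : forall j, K ord0 j = 0.
Hypothesis K0r : forall i, K i ord0 = 0.

(* For xi_b = b / u the operator T(xi_a) is a multiple of [tilted u a], which is
   polynomial in u and reduces to eta K_a at u = 0. *)
Definition tilted (u : C) (a : 'I_N) : op C H := fun c d =>
  transfer (@gsp C) (@gse C) K (fun n => (n != a)%:R)
    (fun n => eta * (if n == a then 1 else u / ((a : nat)%:R - (n : nat)%:R)))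
    (unitvec C d) c.

Lemma mon_pass (al be : 'I_N -> C) s u i (c : H) :
  {in s, forall n, al n = 1 /\ be n = 0} ->
  mon (@gsp C) (@gse C) al be s u i c = (\prod_(n <- s) gsp C i (c n)) * u i c.
Proof.
elim: s i c => [|n s IH] i c sP; first by rewrite big_nil mul1r.
have [an bn] := sP n (mem_head _ _).
rewrite big_cons /= /lop an bn !mul0r addr0 mul1r IH ?mulrA //.
by move=> m ms; apply: sP; rewrite inE ms orbT.
Qed.

Lemma gsp_odd i s : i != ord0 -> gsp C i s = 1.
Proof. by move=> i0; rewrite /gsp /deg i0 mulnC exprM sqrrN !expr1n. Qed.

(** At [u = 0] the other sites are transparent, and site [a] swaps its state with the auxiliary one.
    The sign of the odd exchange cancels that of the supertrace. *)
Lemma tilted0 a v c :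
  opapp (tilted 0 a) v c = eta * \sum_j K (c a) j * v (upd c a j).
Proof.
have key w : transfer (@gsp C) (@gse C) K (fun n => (n != a)%:R)
    (fun n => eta * (if n == a then 1 else 0 / ((a : nat)%:R - (n : nat)%:R))) w c
    = eta * \sum_j K (c a) j * w (upd c a j).
  rewrite /transfer.
  have : a \in sites N by rewrite mem_rev mem_enum.
  have := sites_uniq N; move: (sites N) => s us as_.
  case/splitPr: as_ us => s1 s2; rewrite uniq_catC /= mem_cat negb_or.
  move=> /andP[/andP[as2 as1] _].
  pose al (n : 'I_N) : C := (n != a)%:R.
  pose be (n : 'I_N) : C :=
    eta * (if n == a then 1 else 0 / ((a : nat)%:R - (n : nat)%:R)).
  rewrite -/al -/be.
  have pass s' : a \notin s' -> {in s', forall n, al n = 1 /\ be n = 0}.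
    move=> as' n ns; have na : n != a by apply: contraNneq as' => <-.
    by rewrite /al /be na (negPf na) mul0r mulr0.
  rewrite -sumrN -(pair_bigA _ (fun i j => - (K i j * mon _ _ al be (s1 ++ a :: s2)
     (aux1 i w) j c))) /= exchange_big mulr_sumr; apply: eq_bigr => j _ /=.
  have [->|j0] := eqVneq j ord0.
    by rewrite K0r mul0r mulr0 big1 // => i _; rewrite K0r mul0r oppr0.
  have E i : mon (@gsp C) (@gse C) al be (s1 ++ a :: s2) (aux1 i w) j c =
     - eta * ((\prod_(n <- s2) gsp C (c a) (upd c a j n)) * aux1 i w (c a) (upd c a j)).
    rewrite /mon foldr_cat -/(mon _ _ _ _ _ _) mon_pass; last exact: pass.
    rewrite big1 ?mul1r => [|n _]; last exact: gsp_odd.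
    rewrite [foldr _ _ (a :: s2)]/=.
    have -> U : lop (@gsp C) (@gse C) al be a U j c = - eta * U (c a) (upd c a j).
      by rewrite /lop /al /be eqxx /gse /deg j0 /=; ring.
    by rewrite -/(mon _ _ _ _ _ _) mon_pass; last exact: pass.
  under eq_bigr do rewrite E.
  rewrite (bigD1 (c a)) //= [X in _ + X]big1 ?addr0 => [|i ia]; last first.
    by rewrite /aux1 eq_sym (negPf ia) mul0r !mulr0 oppr0.
  rewrite /aux1 eqxx mul1r.
  have [->|ca] := eqVneq (c a) ord0; first by rewrite K0l !mul0r oppr0 mulr0.
  rewrite big1 => [|n _]; last exact: gsp_odd.
  by ring.
rewrite /opapp; under eq_bigr => d _ do rewrite /tilted key -mulrA mulr_suml.
rewrite -mulr_sumr; congr (_ * _); rewrite exchange_big; apply: eq_bigr => j _ /=.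
rewrite (bigD1 (upd c a j)) //= /unitvec eqxx mulr1 [X in _ + X]big1 ?addr0 // => d dc.
by rewrite eq_sym (negPf dc) mulr0 mul0r.
Qed.

Lemma tilted_curve (u : C) (a : 'I_N) v c : u != 0 ->
  let xi := fun b : 'I_N => (b : nat)%:R / u in
  transfer (@gsp C) (@gse C) K (fun n => xi a - xi n) (fun=> eta) v c
  = (\prod_(n | n != a) (xi a - xi n)) *
    transfer (@gsp C) (@gse C) K (fun n => (n != a)%:R)
    (fun n => eta * (if n == a then 1 else u / ((a : nat)%:R - (n : nat)%:R))) v c.
Proof.
move=> u0 xi; pose k n := if n == a then 1 else xi a - xi n.
have -> : \prod_(n | n != a) (xi a - xi n) = \prod_n k n.
  rewrite [RHS](bigD1 a) //= /k eqxx mul1r; apply: eq_bigr => n /negPf na.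
  by rewrite na.
rewrite -transfer_scale; congr (transfer _ _ _ _ _ _ _);
  apply: functional_extensionality => n; rewrite /k.
  by case: eqVneq => [->|na]; rewrite ?subrr ?mul0r ?mulr1 // mulr0.
case: eqVneq => [_|na]; first by rewrite mul1r mulr1.
have an : (a : nat)%:R - (n : nat)%:R != 0 :> C.
  by rewrite subr_eq0 eqr_nat eq_sym.
by rewrite /xi; field; rewrite u0 an.
Qed.

End BasePoint.

(** * The base point *)

Section Tensor.
Variables (C : numClosedFieldType) (N : nat).
Local Notation H := (hconf N).

Definition tens (b : 'I_3 -> 'I_3 -> C) (c d : H) : C := \prod_a b (c a) (d a).

Lemma tens_mul (b b' : 'I_3 -> 'I_3 -> C) :
  (forall i k, \sum_j b i j * b' j k = (i == k)%:R) ->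
  forall h k, \sum_d tens b h d * tens b' d k = (h == k)%:R.
Proof.
move=> bb' h k; rewrite /tens; under eq_bigr do rewrite -big_split /=.
rewrite -(bigA_distr_bigA (fun a j => b (h a) j * b' j (k a))) /=.
under eq_bigr do rewrite bb'.
have [->|hk] := eqVneq h k; first by rewrite big1 // => a _; rewrite eqxx.
have [a ha] : exists a, h a != k a.
  apply/existsP; rewrite -negb_forall; apply: contra hk => /forallP E.
  by apply/eqP/ffunP => a; apply/eqP.
by rewrite (bigD1 a) //= (negPf ha) mul0r.
Qed.

(** The successor form of the dimension gives square matrices their ring structure, needed for
    [horner_mx]. *)
Lemma conf_index : exists n, exists e : 'I_n.+1 -> H, exists2 e' : H -> 'I_n.+1,
  cancel e e' & cancel e' e.
Proof.
have c : #|H| = #|H|.-1.+1 by rewrite prednK //; apply/card_gt0P; exists [ffun=> ord0].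
exists #|H|.-1, (fun i => enum_val (cast_ord (esym c) i)), (fun h => cast_ord c (enum_rank h)).
  by move=> i; rewrite enum_valK cast_ordKV.
by move=> h; rewrite cast_ordK enum_rankK.
Qed.

(** Take powers of one number [z]: each coincidence of two sums is a nonzero polynomial condition on
    [z], and there are finitely many pairs. *)
Lemma separating_weights (kap : 'I_3 -> C) : injective kap ->
  exists w : 'I_N -> C, injective (fun l : H => \sum_a w a * kap (l a)).
Proof.
move=> ki.
pose r (p : H * H) := \sum_(a < N) (kap (p.1 a) - kap (p.2 a)) *: 'X^a.
have r0 p : p.1 != p.2 -> r p != 0.
  apply: contra_neq => rp; apply/ffunP => a; apply: ki; apply/eqP.
  rewrite -subr_eq0; have := congr1 (fun q : {poly C} => q`_a) rp.
  rewrite coef0 coef_sum (bigD1 a) //= coefZ coefXn eqxx mulr1 big1 ?addr0 => [->//|b ba].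
  by rewrite coefZ coefXn (inj_eq val_inj) eq_sym (negPf ba) mulr0.
have [|z _ rz] := @poly_nonroot C (\prod_(p | p.1 != p.2) r p).
  by apply/prodf_neq0 => p; apply: r0.
exists (fun a => z ^+ a) => l l' E; apply/eqP; move: rz; apply: contraNT => ll'.
rewrite horner_prod (bigD1 (l, l')) //= mulf_eq0; apply/orP; left.
rewrite /r horner_sum; under eq_bigr do rewrite hornerZ hornerXn mulrBl /=.
by rewrite sumrB subr_eq0; apply/eqP; under eq_bigr do rewrite mulrC;
  rewrite E; apply: eq_bigr => a _; rewrite mulrC.
Qed.

End Tensor.

Section MatrixOfOp.
Variables (C : numClosedFieldType) (N n : nat).
Local Notation H := (hconf N).
Variables (e : 'I_n.+1 -> H) (e' : H -> 'I_n.+1).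
Hypotheses (eK : cancel e e') (e'K : cancel e' e).

Lemma sum_conf (F : H -> C) : \sum_d F d = \sum_i F (e i).
Proof. by rewrite (reindex e) //; apply: onW_bij; exists e'. Qed.

Definition mat (O : H -> H -> C) : 'M[C]_n.+1 := \matrix_(i, j) O (e i) (e j).

Lemma mat_mul A B : mat A *m mat B = mat (opmul A B).
Proof.
apply/matrixP => i j; rewrite !mxE /opmul sum_conf.
by apply: eq_bigr => k _; rewrite !mxE.
Qed.

Lemma mat_id : mat (fun c d => (c == d)%:R) = 1%:M.
Proof. by apply/matrixP => i j; rewrite !mxE (can_eq eK). Qed.

Lemma mat_unit (A B : H -> H -> C) :
  (forall h k, \sum_d A h d * B d k = (h == k)%:R) -> mat A \in unitmx.
Proof.
move=> AB; have : mat A *m mat B = 1%:M.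
  by rewrite mat_mul -mat_id; apply/matrixP => i j; rewrite !mxE; apply: AB.
by case/mulmx1_unit.
Qed.

Definition covmat (O : 'I_N -> op C H) (S : vec C H) : 'M[C]_n.+1 :=
  mat (fun h d => cov O S h (unitvec C d)).

Lemma covmat_linindep O S : \det (covmat O S) != 0 ->
  linindep (fun h d => cov O S h (unitvec C d)).
Proof.
move=> dM a aE; pose r := \row_i a (e i).
have r0 : r = 0.
  have U : covmat O S \in unitmx by rewrite unitmxE unitfE.
  rewrite -[r](mulmxK U) (_ : r *m _ = 0) ?mul0mx //; apply/rowP => j.
  rewrite !mxE -[RHS](aE (e j)) sum_conf; apply: eq_bigr => i _.
  by rewrite !mxE.
by move=> h; have := congr1 (fun s : 'rV_ _ => s 0 (e' h)) r0; rewrite !mxE e'K.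
Qed.

Variables (eta : C) (K q q' : 'I_3 -> 'I_3 -> C) (kap : 'I_3 -> C).
Hypothesis eta0 : eta != 0.
Hypothesis K0l : forall j, K ord0 j = 0.
Hypothesis K0r : forall i, K i ord0 = 0.
Hypothesis qq' : forall i k, \sum_j q i j * q' j k = (i == k)%:R.
Hypothesis q'q : forall i k, \sum_j q' i j * q j k = (i == k)%:R.
Hypothesis Kq : forall i l, \sum_j K i j * q j l = q i l * kap l.
Hypothesis kap_inj : injective kap.
Local Notation O0 := (@tilted C N eta K 0).

Lemma base_eigen a l c :
  opapp (O0 a) (fun c => tens q c l) c = eta * kap (l a) * tens q c l.
Proof.
rewrite tilted0 // -mulrA; congr (_ * _).
rewrite [X in _ = _ * X]/tens (bigD1 a) //= mulrA [kap _ * _]mulrC -Kq mulr_suml.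
apply: eq_bigr => j _; rewrite -mulrA; congr (_ * _).
rewrite /tens (bigD1 a) //= upd_same; congr (_ * _); apply: eq_bigr => b ba.
by rewrite upd_other.
Qed.

Lemma base_simple w : injective (fun l : H => \sum_a w a * kap (l a)) ->
  simple_spec (\sum_a w a *: mat (O0 a)).
Proof.
move=> wi; pose Q := mat (tens q).
have Qu : Q \in unitmx := mat_unit (tens_mul qq').
pose d : 'rV[C]_n.+1 := \row_i (eta * \sum_a w a * kap (e i a)).
exists (invmx Q); first by rewrite unitmx_inv.
exists d.
  move=> i j; rewrite !mxE => /(mulfI eta0)/wi; exact: (can_inj eK).
rewrite invmxK; apply: (canRL (mulmxK Qu)).
rewrite mulmx_suml; apply/matrixP => i j.
rewrite summxE mul_mx_diag !mxE mulrC !mulr_sumr mulr_suml; apply: eq_bigr => a _.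
rewrite -scalemxAl mxE.
have -> : (mat (O0 a) *m Q) i j = opapp (O0 a) (fun c => tens q c (e j)) (e i).
  by rewrite mxE /opapp sum_conf; apply: eq_bigr => k _; rewrite !mxE.
by rewrite base_eigen; ring.
Qed.

(** The covector is the sum of the dual product basis, so it pairs to 1 with every product
    eigenvector. In that eigenbasis the covector matrix is a tensor power of the 3x3 Vandermonde
    matrix of the numbers [eta * kap j]. *)
Lemma base_cov : \det (covmat O0 (fun c => \sum_l tens q' l c)) != 0.
Proof.
set S0 := fun c => _.
pose Q := mat (tens q); pose B : 'M[C]_3 := Vandermonde 3 (\row_j (eta * kap j)).
have Qu : Q \in unitmx := mat_unit (tens_mul qq').
have Bu : B \in unitmx.
  rewrite unitmxE unitfE det_Vandermonde; apply/prodf_neq0 => i _.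
  apply/prodf_neq0 => j ij; rewrite !mxE -mulrBr mulf_neq0 // subr_eq0 (inj_eq kap_inj).
  by rewrite -val_eqE neq_ltn ij orbT.
have Vu : mat (tens (fun i j => B i j)) \in unitmx.
  apply: (mat_unit (B := tens (fun i j => invmx B i j))); apply: tens_mul => i k.
  by have := congr1 (fun M : 'M_3 => M i k) (mulmxV Bu); rewrite !mxE.
have E : covmat O0 S0 *m Q = mat (tens (fun i j => B i j)).
  apply/matrixP => i j; rewrite !mxE.
  transitivity (cov O0 S0 (e i) (fun c => tens q c (e j))).
    by rewrite cov_linear sum_conf; apply: eq_bigr => k _; rewrite !mxE.
  rewrite (cov_eigen (x := fun a => eta * kap (e j a))); last first.
    by move=> a c; rewrite base_eigen.
  have -> : \sum_c S0 c * tens q c (e j) = 1.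
    rewrite /S0; under eq_bigr do rewrite mulr_suml.
    rewrite exchange_big /=; under eq_bigr do rewrite (tens_mul q'q).
    by rewrite (bigD1 (e j)) //= eqxx big1 ?addr0 // => l /negPf->.
  by rewrite mulr1; apply: eq_bigr => a _; rewrite !mxE.
move: Vu; rewrite -E unitmxE unitfE det_mulmx mulf_eq0 negb_or.
by case/andP.
Qed.

End MatrixOfOp.

(** * Genericity *)

Section TwistBasis.
Variables (C : numClosedFieldType) (K2 : 'M[C]_2) (k2 k3 : C).

Definition bordered (M : 'M[C]_2) (i j : 'I_3) : C :=
  match unlift ord0 i, unlift ord0 j with
  | Some a, Some b => M a b | None, None => 1 | _, _ => 0 end.

Lemma bordered00 M : bordered M ord0 ord0 = 1.
Proof. by rewrite /bordered unlift_none. Qed.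

Lemma bordered0S M b : bordered M ord0 (lift ord0 b) = 0.
Proof. by rewrite /bordered unlift_none liftK. Qed.

Lemma borderedS0 M a : bordered M (lift ord0 a) ord0 = 0.
Proof. by rewrite /bordered unlift_none liftK. Qed.

Lemma borderedSS M a b : bordered M (lift ord0 a) (lift ord0 b) = M a b.
Proof. by rewrite /bordered !liftK. Qed.

Lemma bordered_mul M M' : M *m M' = 1%:M ->
  forall i k, \sum_j bordered M i j * bordered M' j k = (i == k)%:R.
Proof.
move=> MM' i k; rewrite big_ord_recl.
case: (unliftP ord0 i) => [a ->|->]; case: (unliftP ord0 k) => [b ->|->].
- rewrite borderedS0 mul0r add0r (inj_eq lift_inj).
  have := congr1 (fun A : 'M_2 => A a b) MM'; rewrite !mxE => <-.
  by apply: eq_bigr => j _; rewrite !borderedSS.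
- rewrite borderedS0 mul0r add0r big1 // => j _.
  by rewrite borderedS0 mulr0.
- rewrite bordered0S mulr0 add0r big1 // => j _.
  by rewrite bordered0S mul0r.
- rewrite !bordered00 mulr1 big1 ?addr0 // => j _.
  by rewrite bordered0S mul0r.
Qed.

Hypothesis K2diag : exists2 P : 'M[C]_2, P \in unitmx &
   K2 = invmx P *m diag_mx (\row_i [:: k2; k3]`_i) *m P.
Hypothesis k23 : k2 != k3.
Hypothesis k230 : k2 * k3 != 0.

Lemma twist_eigenbasis : exists q q' : 'I_3 -> 'I_3 -> C, exists kap : 'I_3 -> C,
  [/\ forall i k, \sum_j q i j * q' j k = (i == k)%:R,
      forall i k, \sum_j q' i j * q j k = (i == k)%:R,
      forall i l, \sum_j Khat K2 i j * q j l = q i l * kap l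
    & injective kap].
Proof.
have [P Pu E] := K2diag.
exists (bordered (invmx P)), (bordered P), (fun l => [:: 0; k2; k3]`_l); split.
- exact/bordered_mul/mulVmx.
- exact/bordered_mul/mulmxV.
- move=> i l; rewrite big_ord_recl Khat0r mul0r add0r.
  case: (unliftP ord0 i) => [a ->|->]; last first.
    rewrite big1 => [|j _]; last by rewrite Khat0l mul0r.
    case: (unliftP ord0 l) => [b ->|->]; first by rewrite bordered0S mul0r.
    by rewrite mulr0.
  case: (unliftP ord0 l) => [b ->|->]; last first.
    by rewrite mulr0 big1 // => j _; rewrite borderedS0 mulr0.
  have := congr1 (fun M => (M *m invmx P) a b) E; rewrite mulmxK // mul_mx_diag !mxE.
  rewrite borderedSS => <-; apply: eq_bigr => j _.
  by rewrite KhatS borderedSS.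
move: k230; rewrite mulf_eq0 negb_or => /andP[k20 k30].
have k32 : k3 != k2 by rewrite eq_sym.
move=> [[|[|[|i]]] li] [[|[|[|j]]] lj] //= /eqP; rewrite ?(negPf k20) ?(negPf k30)
  ?(negPf k23) ?(negPf k32) // 1?eq_sym ?(negPf k20) ?(negPf k30) // => _;
  exact: val_inj.
Qed.

End TwistBasis.

Section Generic.
Variables (C : numClosedFieldType) (N n : nat) (eta : C).
Local Notation H := (hconf N).
Variables (e : 'I_n.+1 -> H) (e' : H -> 'I_n.+1).
Hypotheses (eK : cancel e e') (e'K : cancel e' e).
Variable K2 : 'M[C]_2.
Local Notation K := (Khat K2).

Lemma T1_entry (xi : 'I_N -> C) lam c d : T1 K eta xi lam c d =
  transfer (@gsp C) (@gse C) K (fun n => lam - xi n) (fun=> eta) (unitvec C d) c.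
Proof. by rewrite -opapp_unitvec opapp_T1_Khat. Qed.

Definition gaps (xi : 'I_N -> C) a : C := \prod_(n | n != a) (xi a - xi n).

(** The weights clear denominators: along the curve every [T(xi_a)] carries the factor [gaps xi a],
    and these products turn it into a factor common to all terms while keeping the entries
    polynomial. *)
Definition theta (w xi : 'I_N -> C) : 'M[C]_n.+1 :=
  \sum_a (w a * \prod_(b | b != a) gaps xi b) *: mat e (T1 K eta xi (xi a)).

Definition genericity (w : 'I_N -> C) (S0 : vec C H) (xi : 'I_N -> C) : C :=
  cert (theta w xi) * \det (covmat e (fun a => T1 K eta xi (xi a)) S0).

Lemma mpolyfun_T1 a c d : mpolyfun (fun xi : 'I_N -> C => T1 K eta xi (xi a) c d).
Proof.
have cl := mpolyfun_ring C 'I_N.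
eapply class_ext; first by move=> xi; rewrite T1_entry; reflexivity.
apply: (@class_transfer C N _ _ cl _ _ _ (fun xi n => xi a - xi n) (fun _ _ => eta)
  (fun=> unitvec C d)) => [m|m|b]; try exact: (class_const cl).
by apply: (classD cl); [|apply: (classN cl)]; exact: mpolyfun_coord.
Qed.

Lemma mpolyfun_genericity w S0 : mpolyfun (genericity w S0).
Proof.
have cl := mpolyfun_ring C 'I_N; apply: (classM cl).
  apply: (class_cert cl) => i j.
  eapply class_ext; first by move=> xi; rewrite summxE; reflexivity.
  apply: (class_sum cl) => a; eapply class_ext; first by move=> xi; rewrite !mxE; reflexivity.
  apply: (classM cl); last exact: mpolyfun_T1.
  apply: (classM cl); first exact: (class_const cl).
  apply: (class_prod cl) => b; apply: (class_prod cl) => m.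
  by apply: (classD cl); [|apply: (classN cl)]; exact: mpolyfun_coord.
apply: (class_det cl) => i j; eapply class_ext; first by move=> xi; rewrite !mxE; reflexivity.
apply: (@class_cov C N _ _ cl (fun xi a => T1 K eta xi (xi a)) (fun=> S0)
  (fun=> unitvec C (e j))); [exact: mpolyfun_T1 | |]; move=> c; exact: (class_const cl).
Qed.

Lemma mpolyfun_covmat O : mpolyfun (fun S : H -> C => \det (covmat e O S)).
Proof.
have cl := mpolyfun_ring C H.
apply: (class_det cl) => i j; eapply class_ext; first by move=> S; rewrite !mxE; reflexivity.
apply: (@class_cov C N _ _ cl (fun=> O) id (fun=> unitvec C (e j))) => [m c d|c|c];
  try exact: (class_const cl); exact: mpolyfun_coord.
Qed.

Section Curve.
Variables (w : 'I_N -> C) (S0 : vec C H).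

Definition tilted_genericity (u : C) : C :=
  cert (\sum_a w a *: mat e (@tilted C N eta K u a)) *
  \det (covmat e (@tilted C N eta K u) S0).

Lemma polyfun_tilted_genericity : polyfun tilted_genericity.
Proof.
have cl := polyfun_ring C.
have Pt a c d : polyfun (fun u => @tilted C N eta K u a c d).
  apply: (@class_transfer C N _ _ cl _ _ _ (fun _ m => (m != a)%:R)
    (fun u m => eta * (if m == a then 1 else u / ((a : nat)%:R - (m : nat)%:R)))
    (fun=> unitvec C d)) => [m|m|b]; try exact: (class_const cl).
  apply: (classM cl); first exact: (class_const cl).
  case: (m == a); first exact: (class_const cl).
  by apply: (classM cl); [exact: polyfun_id | exact: (class_const cl)].
apply: (classM cl).
  apply: (class_cert cl) => i j.
  eapply class_ext; first by move=> u; rewrite summxE; reflexivity.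
  apply: (class_sum cl) => a; eapply class_ext; first by move=> u; rewrite !mxE; reflexivity.
  by apply: (classM cl); [exact: (class_const cl) | exact: Pt].
apply: (class_det cl) => i j; eapply class_ext; first by move=> u; rewrite !mxE; reflexivity.
apply: (@class_cov C N _ _ cl (fun u a => @tilted C N eta K u a) (fun=> S0)
  (fun=> unitvec C (e j))); [exact: Pt | |]; move=> c; exact: (class_const cl).
Qed.

Lemma tilted_genericity_neq0 u : u != 0 -> tilted_genericity u != 0 ->
  genericity w S0 (fun b : 'I_N => (b : nat)%:R / u) != 0.
Proof.
move=> u0; set xi := fun b : 'I_N => _.
rewrite /tilted_genericity mulf_eq0 negb_or => /andP[/certP sp cv].
have g0 a : gaps xi a != 0.
  apply/prodf_neq0 => m ma; rewrite /xi -mulrBl mulf_neq0 ?invr_neq0 //.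
  by rewrite subr_eq0 eqr_nat eq_sym.
have TE a : T1 K eta xi (xi a) = fun c d => gaps xi a * @tilted C N eta K u a c d.
  apply: functional_extensionality => c; apply: functional_extensionality => d.
  by rewrite T1_entry tilted_curve.
rewrite /genericity mulf_neq0 //.
  apply/certP; have -> : theta w xi =
     (\prod_a gaps xi a) *: \sum_a w a *: mat e (@tilted C N eta K u a).
    rewrite /theta scaler_sumr; apply: eq_bigr => a _; rewrite TE [in RHS](bigD1 a) //=.
    by apply/matrixP => i j; rewrite !mxE; ring.
  by apply: simple_specZ => //; apply/prodf_neq0.
have -> : covmat e (fun a => T1 K eta xi (xi a)) S0 =
   diag_mx (\row_i \prod_a gaps xi a ^+ (e i) a) *m covmat e (@tilted C N eta K u) S0.
  rewrite mul_diag_mx; apply/matrixP => i j; rewrite !mxE -cov_scale.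
  congr (cov _ _ _ _); apply: functional_extensionality => a; exact: TE.
rewrite det_mulmx det_diag mulf_neq0 //; apply/prodf_neq0 => i _; rewrite mxE.
by apply/prodf_neq0 => a _; rewrite expf_neq0.
Qed.

End Curve.

Variables (k2 k3 : C).
Hypothesis eta0 : eta != 0.
Hypothesis K2diag : exists2 P : 'M[C]_2, P \in unitmx &
   K2 = invmx P *m diag_mx (\row_i [:: k2; k3]`_i) *m P.
Hypothesis k23 : k2 != k3.
Hypothesis k230 : k2 * k3 != 0.

Lemma genericity_neq0 : exists w S0 xi0, genericity w S0 xi0 != 0.
Proof.
have [q [q' [kap [qq' q'q Kq ki]]]] := twist_eigenbasis K2diag k23 k230.
have [w wi] := separating_weights N ki.
pose S0 : vec C H := fun c => \sum_l tens q' l c.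
have [|u u0 gu] := polyfun_nonroot (polyfun_tilted_genericity w S0).
  rewrite /tilted_genericity mulf_neq0 //.
    apply/certP; apply: (base_simple eK e'K eta0 _ _ qq' Kq wi) => ?;
      [exact: Khat0l | exact: Khat0r].
  apply: (base_cov eK e'K eta0 _ _ qq' q'q Kq ki) => ?;
    [exact: Khat0l | exact: Khat0r].
by exists w, S0, (fun b : 'I_N => (b : nat)%:R / u); apply: tilted_genericity_neq0.
Qed.

Variables (xi : 'I_N -> C).
Hypothesis gen : forall a b : 'I_N, a != b ->
  forall z : int, xi a - xi b != z%:~R * eta.
Local Notation T := (T1 K eta xi).

Lemma T1_comm a b : mat e (T (xi a)) *m mat e (T (xi b))
  = mat e (T (xi b)) *m mat e (T (xi a)).
Proof.
have [->//|ab] := eqVneq a b.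
rewrite !(mat_mul eK e'K); apply/matrixP => i j; rewrite !mxE.
rewrite -!opapp_unitvec !opapp_opmul.
have tE lam v : opapp (T lam) v =
    transfer (@gsp C) (@gse C) K (fun n => lam - xi n) (fun=> eta) v.
  by apply: functional_extensionality => c; apply: opapp_T1_Khat.
rewrite !tE; apply: (@transfer_comm _ _ _ (@Khat0l _ K2) (@Khat0r _ K2) _ _ _ (xi a - xi b)).
  by move=> m; ring.
rewrite eqf_sqr negb_or; have := gen ab 1; have := gen ab (-1).
by rewrite mulrN1z mulN1r mul1r => -> ->.
Qed.

(** All [T(xi_a)] commute with [theta], so they are diagonal in the basis where it is diagonal with
    distinct entries. As [theta] is a combination of them, equal joint eigenvalues would force equal
    entries of [d]. *)
Lemma joint_eigenbasis w : cert (theta w xi) != 0 ->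
  exists (vs : H -> vec C H) (x : H -> 'I_N -> C),
  [/\ linindep vs, forall h a c, opapp (T (xi a)) (vs h) c = x h a * vs h c
    & forall h h', (forall a, x h a = x h' a) -> h = h'].
Proof.
move=> /certP[P Pu [d di AE]]; pose Q := invmx P.
have Qu : Q \in unitmx by rewrite unitmx_inv.
pose M a := mat e (T (xi a)); pose D a := P *m M a *m Q.
have thM a : theta w xi *m M a = M a *m theta w xi.
  rewrite mulmx_suml mulmx_sumr; apply: eq_bigr => b _.
  by rewrite -scalemxAl -scalemxAr T1_comm.
have DP a : D a *m P = P *m M a by rewrite /D mulmxKV.
have thP : P *m theta w xi = diag_mx d *m P by rewrite AE -mulmxA mulKVmx.
have dD a : diag_mx d *m D a = D a *m diag_mx d.
  apply: (can_inj (mulmxK Pu)); rewrite -[LHS]mulmxA DP [LHS]mulmxA -thP -mulmxA thM.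
  by rewrite mulmxA -DP -!mulmxA thP.
have D0 a i j : i != j -> D a i j = 0.
  move=> ij; have := congr1 (fun A : 'M_ _ => A i j) (dD a).
  rewrite mul_mx_diag mul_diag_mx !mxE [RHS]mulrC => /eqP.
  rewrite -subr_eq0 -mulrBl mulf_eq0 subr_eq0 (inj_eq di) (negPf ij).
  by move/eqP.
have MQ a : M a *m Q = Q *m D a by rewrite /D !mulmxA mulVmx // mul1mx.
have eig h a c : opapp (T (xi a)) (fun c => Q (e' c) (e' h)) c
    = D a (e' h) (e' h) * Q (e' c) (e' h).
  transitivity ((M a *m Q) (e' c) (e' h)).
    rewrite mxE /opapp (sum_conf eK e'K); apply: eq_bigr => k _.
    by rewrite mxE e'K eK.
  rewrite MQ mxE (bigD1 (e' h)) //= big1 ?addr0 1?mulrC // => k kh.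
  by rewrite D0 ?mulr0.
exists (fun h c => Q (e' c) (e' h)), (fun h a => D a (e' h) (e' h)); split=> //.
- move=> a aE h; pose r := \col_i a (e i).
  have r0 : r = 0.
    rewrite -[r](mulKmx Qu) (_ : Q *m r = 0) ?mulmx0 //; apply/colP => i.
    rewrite !mxE -[RHS](aE (e i)) (sum_conf eK e'K); apply: eq_bigr => k _.
    by rewrite !mxE !eK mulrC.
  by have := congr1 (fun s : 'cV_ _ => s (e' h) 0) r0; rewrite !mxE e'K.
move=> h h' E; apply: (can_inj e'K); apply: di.
have dE i : d 0 i = \sum_a (w a * \prod_(b | b != a) gaps xi b) * D a i i.
  have : diag_mx d = \sum_a (w a * \prod_(b | b != a) gaps xi b) *: D a.
    have -> : diag_mx d = P *m theta w xi *m Q by rewrite thP mulmxK.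
    rewrite /theta mulmx_sumr mulmx_suml; apply: eq_bigr => a _.
    by rewrite -scalemxAr -scalemxAl.
  move/(congr1 (fun A : 'M_ _ => A i i)); rewrite mxE eqxx mulr1n summxE => ->.
  by apply: eq_bigr => a _; rewrite mxE.
by rewrite !dE; apply: eq_bigr => a _; rewrite E.
Qed.

End Generic.

Theorem mainTheorem7 (C : numClosedFieldType) (N : nat) (HN : (0 < N)%N)
  (eta : C) (Heta : eta != 0) (K2 : 'M[C]_2) (k2 k3 : C)
  (Hk : k2 != k3) (Hk0 : k2 * k3 != 0)
  (Hdiag : exists2 P : 'M[C]_2, P \in unitmx &
             K2 = invmx P *m diag_mx (\row_i [:: k2; k3]`_i) *m P) :
  let T := T1 (Khat K2) eta in
  exists p : seq (C * ('I_N -> nat)),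
    (exists xi0 : 'I_N -> C, mpeval p xi0 != 0) /\
    forall xi : 'I_N -> C,
      mpeval p xi != 0 ->
      (forall a b : 'I_N, a != b -> forall z : int, xi a - xi b != z%:~R * eta) ->
      (* the eigenvalues of T_1(lambda) are exactly Sigma *)
      (forall t : C -> C,
         is_eigenvalue (T xi) t <->
         exists x : 'I_N -> C, inS k2 k3 eta xi x /\
                               forall lam, t lam = t1x k2 k3 eta xi x lam) /\
      (* diagonalizable with simple spectrum *)
      (exists (vs : hconf N -> vec C (hconf N)) (ts : hconf N -> C -> C),
         linindep vs /\
         (forall h lam c, opapp (T xi lam) (vs h) c = ts h lam * vs h c) /\
         (forall h h', h != h' -> exists lam, ts h lam != ts h' lam)) /\
      (* SoV covector basis for generic <S| and eigenvector characterization *)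
      (exists q : seq (C * (hconf N -> nat)),
         (exists S0 : hconf N -> C, mpeval q S0 != 0) /\
         forall S : vec C (hconf N),
           mpeval q S != 0 ->
           linindep (fun h : hconf N => fun d : hconf N =>
                        covh (T xi) xi S h (unitvec C d)) /\
           forall x : 'I_N -> C, inS k2 k3 eta xi x ->
             exists v : vec C (hconf N),
               nonzero_vec v /\
               (forall lam c, opapp (T xi lam) v c = t1x k2 k3 eta xi x lam * v c) /\
               forall h : hconf N,
                 covh (T xi) xi S h v =
                 \prod_(n < N) t1x k2 k3 eta xi x (xi n) ^+ h n).
Proof.
move=> T; have [n [e [e' eK e'K]]] := conf_index N.
have [w [S0 [xi0 g0]]] := genericity_neq0 eK e'K Heta Hdiag Hk Hk0.
have [p pE] := mpolyfun_genericity eta e K2 w S0.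
exists p; split; first by exists xi0; rewrite pE.
move=> xi; rewrite pE mulf_eq0 negb_or => /andP[th cv] gen.
have [vs [x [vsf vsE xi_]]] := joint_eigenbasis eK e'K gen th.
have xinj := gen_inj gen.
have vsT h lam c : opapp (T xi lam) (vs h) c = t1x k2 k3 eta xi (x h) lam * vs h c.
  exact: (T1_eigen gen Hdiag (vsE h)).
have vs0 h : nonzero_vec (vs h).
  have [/existsP[c vc]|] := boolP [exists c, vs h c != 0]; first by exists c.
  rewrite negb_exists => /forallP none.
  have abs := vsf (fun h' => (h' == h)%:R); case/eqP: (oner_neq0 C).
  rewrite -[RHS](abs _ h) ?eqxx // => c.
  rewrite big1 // => h' _; case: eqVneq => [->|_]; last by rewrite mul0r.
  by have := none c; rewrite negbK => /eqP->; rewrite mulr0.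
have xS h : inS k2 k3 eta xi (x h).
  have tE : is_eigenvalue (T xi) (t1x k2 k3 eta xi (x h)).
    by exists (vs h); split=> // lam c; rewrite vsT.
  have := eigenvalue_inS Heta gen Hdiag tE.
  suff -> : (fun a => t1x k2 k3 eta xi (x h) (xi a)) = x h by [].
  by apply: functional_extensionality => a; rewrite t1x_node.
have complete y : inS k2 k3 eta xi y -> exists h, x h = y.
  move=> /(solutions_complete Heta gen xS xi_)[h E]; exists h.
  exact: functional_extensionality.
split; [|split].
- move=> t; split=> [tE|[y [/complete[h <-] tE]]].
    exists (fun a => t (xi a)); split; first exact: eigenvalue_inS tE.
    exact: eigenvalue_t1x tE.
  by exists (vs h); split=> // lam c; rewrite vsT tE.
- exists vs, (fun h => t1x k2 k3 eta xi (x h)); split=> //; split=> // h h' hh'.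
  have [/existsP[a xa]|] := boolP [exists a, x h a != x h' a].
    by exists (xi a); rewrite !t1x_node.
  rewrite negb_exists => /forallP none; case/eqP: hh'; apply: xi_ => a.
  by have := none a; rewrite negbK => /eqP.
have [q qE] := mpolyfun_covmat e (fun a => T xi (xi a)).
(* The second factor of [genericity] was put into [p] so that the fixed [S0] witnesses [q] at every
   admissible [xi]. *)
exists q; split; first by exists S0; rewrite qE.
move=> S; rewrite qE => cvS.
have li := covmat_linindep eK e'K cvS.
split=> // y /complete[h <-].
pose s := \sum_c S c * vs h c.
have cE k : covh (T xi) xi S k (vs h) = (\prod_m x h m ^+ k m) * s.
  by rewrite covhE; apply: cov_eigen => a c; apply: vsE.
(* Were [s] zero, every covector would kill [vs h], contradicting invertibility of the covector
   matrix. Dividing by [s] fixes the normalization [<S|t> = 1]. *)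
have s0 : s != 0.
  apply/eqP => s0; have [c vc] := vs0 h.
  have U : covmat e (fun a => T xi (xi a)) S \in unitmx by rewrite unitmxE unitfE.
  pose r := \col_i vs h (e i).
  have r0 : r = 0.
    rewrite -[r](mulKmx U) (_ : _ *m r = 0) ?mulmx0 //; apply/colP => i; rewrite !mxE.
    have := cE (e i); rewrite s0 mulr0 covhE cov_linear => E; rewrite -[RHS]E.
    by rewrite (sum_conf eK e'K); apply: eq_bigr => k _; rewrite !mxE.
  case/eqP: vc; have := congr1 (fun u : 'cV_ _ => u (e' c) 0) r0.
  by rewrite !mxE e'K.
exists (fun c => s^-1 * vs h c); split; [|split].
- by have [c vc] := vs0 h; exists c; rewrite mulf_neq0 ?invr_neq0.
- by move=> lam c; rewrite opappZ vsT mulrCA.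
move=> k; rewrite covhE (cov_eigen (x := x h)) => [|a c].
  have -> : \sum_c S c * (s^-1 * vs h c) = s^-1 * s.
    by rewrite mulr_sumr; apply: eq_bigr => c _; rewrite mulrCA.
  by rewrite mulVf // mulr1; apply: eq_bigr => m _; rewrite t1x_node.
by rewrite opappZ vsE mulrCA.
Qed.
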